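(* Let $\Omega$ be an atomless Borel probability space with measure $\nu$ and let $W:\Omega^2\to[0,1]$ be a graphon. Then $W$ is bipartite if and only if the associated kernel operator $T_W:L^2(\Omega)\to L^2(\Omega)$, $(T_Wf)(x)=\int_\Omega W(x,y)f(y)\,d\nu(y)$, has a symmetric spectrum.
   Context: A graphon is a symmetric measurable function $W:\Omega^2\to[0,1]$. $W$ is bipartite if there is a partition $\Omega=\Omega_1\sqcup\Omega_2$ into measurable sets such that for $i=1,2$, $W=0$ almost everywhere on $\Omega_i\times\Omega_i$. $T_W$ is a self-adjoint Hilbert--Schmidt operator, so it has finitely or countably many nonzero eigenvalues, all real. Its spectrum is called symmetric if each $\lambda\in\mathbb R$ is an eigenvalue of $T_W$ if and only if $-\lambda$ is, and the multiplicities of $\lambda$ and $-\lambda$ are the same. *)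

(* Defs.v *)
From HB Require Import structures.
From mathcomp Require Import all_boot all_order all_algebra.
From mathcomp Require Import all_classical all_reals all_analysis.
From mathcomp Require Import measurable_realfun ess_sup_inf.

Set Implicit Arguments.
Unset Strict Implicit.
Unset Printing Implicit Defensive.

Import Order.TTheory GRing.Theory Num.Theory.
Import numFieldNormedType.Exports.

Local Open Scope classical_set_scope.
Local Open Scope ring_scope.

Section Lspace_ae.
Context d (T : measurableType d) (R : realType).
Variables (mu : {measure set T -> \bar R}) (p : \bar R) (p1 : (1 <= p)%E).
Local Open Scope quotient_scope.

Lemma finite_norm_ae (f g : T -> R) :
  measurable_fun setT f -> measurable_fun setT g -> f = g %[ae mu] ->
  finite_norm mu p f -> finite_norm mu p g.
Proof.
have mpow (r : R) (h : T -> R) : measurable_fun setT h ->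
    @measurable_fun _ _ T (\bar R) setT (fun x => `|(EFin \o h) x| `^ r)%E.
  move=> mh; apply: (measurableT_comp (T2 := \bar R) (T3 := \bar R)
    (f := fun x : \bar R => poweR x r)).
    exact: measurable_poweR.
  by apply: measurableT_comp => //; exact/measurable_EFinP.
move=> mf mg fg; rewrite /finite_norm.
suff -> : Lnorm mu p (EFin \o g) = Lnorm mu p (EFin \o f) by [].
rewrite Lnorm.unlock; case: p p1 => [r| |] p1'; last by move: p1'.
  have -> : (\int[mu]_x `|(EFin \o g) x| `^ r =
             \int[mu]_x `|(EFin \o f) x| `^ r)%E.
    apply: ae_eq_integral; [exact: measurableT|exact: mpow|exact: mpow|].
    by apply: filterS fg => x /= h1 h2; rewrite h1.
  by [].
have -> : ess_sup mu (abse \o (EFin \o g)) = ess_sup mu (abse \o (EFin \o f)).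
  by apply: eq_ess_sup; apply: filterS fg => x /= h; rewrite h.
by [].
Qed.

Local Notation aemfun := {mfun_ mu, T >-> measurableTypeR R}.

(* [LspaceType] is built over the generated sigma-algebra [measurableTypeR R],
   [LfunType] over the canonical Borel structure of [R]; the two families of
   measurable sets are convertible. *)
Let mfunR (f : LfunType mu p1) : {mfun T >-> measurableTypeR R} :=
  HB.pack_for {mfun T >-> measurableTypeR R} (f : T -> measurableTypeR R)
    (isMeasurableFun.Build _ _ T (measurableTypeR R) f
       (@measurable_funPT _ _ _ _ f)).

Let cls (f : LfunType mu p1) : aemfun := \pi_aemfun (mfunR f).

Let cls_ae (f : LfunType mu p1) : (cls f : T -> R) = f %[ae mu].
Proof.
have : ae_eq_op mu (repr (cls f)) (mfunR f).
  by rewrite -eqmodE /cls reprK.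
by move/asboolP.
Qed.

Lemma Lspace_of_subproof (f : LfunType mu p1) : finite_norm mu p (cls f).
Proof.
apply: finite_norm_ae (@Lfunction_finite _ _ _ _ _ p1 f) => //.
  exact: (@measurable_funPT _ _ _ _ (repr (cls f))).
by apply/ae_eq_sym; exact: cls_ae.
Qed.

Definition Lspace_of (f : LfunType mu p1) : LspaceType mu p1 :=
  HB.pack_for (LspaceType mu p1) (cls f)
   (isFinLebesgue.Build _ _ _ _ _ p1 _ (Lspace_of_subproof f)).

Lemma Lfun_of_subproof (u : LspaceType mu p1) : (u : T -> R) \in Lfun mu p.
Proof.
apply/andP; split; rewrite inE/=.
  exact: (@measurable_funPT _ _ _ _ (repr (u : aemfun))).
exact: Lebesgue_finite.
Qed.

Definition Lfun_of (u : LspaceType mu p1) : LfunType mu p1 :=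
  Lfun_Sub p1 (Lfun_of_subproof u).

Lemma Lspace_ofK (f : LfunType mu p1) : (Lspace_of f : T -> R) = f %[ae mu].
Proof. exact: cls_ae. Qed.

Lemma Lspace_eqP (u v : LspaceType mu p1) : u = v <-> (u : T -> R) = v %[ae mu].
Proof.
split=> [->|uv]; first exact: ae_eq_refl.
have {}uv : (u : aemfun) = v.
  rewrite -[LHS]reprK -[RHS]reprK; apply/eqmodP.
  by apply/asboolP; exact: uv.
case: u v uv => [u [[fu]]] [v [[fv]]] /= uv.
by rewrite uv in fu *; rewrite (Prop_irrelevance fu fv).
Qed.

Lemma Lspace_ofP (f g : LfunType mu p1) :
  Lspace_of f = Lspace_of g <-> (f : T -> R) = g %[ae mu].
Proof.
split=> [fg|fg].
  apply: ae_eq_trans (ae_eq_sym (Lspace_ofK f)) _.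
  by rewrite fg; exact: Lspace_ofK.
apply/Lspace_eqP; apply: ae_eq_trans (Lspace_ofK f) _.
exact: ae_eq_trans fg (ae_eq_sym (Lspace_ofK g)).
Qed.

Lemma Lfun_ofK (u : LspaceType mu p1) : Lspace_of (Lfun_of u) = u.
Proof. by apply/Lspace_eqP; exact: Lspace_ofK. Qed.

HB.instance Definition _ := gen_eqMixin (LspaceType mu p1).
HB.instance Definition _ := gen_choiceMixin (LspaceType mu p1).

(* The vector space structure of L^p, inherited from that of [LfunType] through
   the quotient map [Lspace_of]. *)
Definition Lspace_zero : LspaceType mu p1 := Lspace_of 0.
Definition Lspace_opp (u : LspaceType mu p1) := Lspace_of (- Lfun_of u).
Definition Lspace_add (u v : LspaceType mu p1) :=
  Lspace_of (Lfun_of u + Lfun_of v).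
Definition Lspace_scale (a : R) (u : LspaceType mu p1) :=
  Lspace_of (a *: Lfun_of u).

Let addE (f g : LfunType mu p1) :
  Lspace_add (Lspace_of f) (Lspace_of g) = Lspace_of (f + g).
Proof.
apply/Lspace_ofP; apply: filterS2 (Lspace_ofK f) (Lspace_ofK g) => x /= h1 h2 _.
change ((Lspace_of f : T -> R) x + (Lspace_of g : T -> R) x = f x + g x).
by rewrite h1// h2.
Qed.

Let oppE (f : LfunType mu p1) : Lspace_opp (Lspace_of f) = Lspace_of (- f).
Proof.
apply/Lspace_ofP; apply: filterS (Lspace_ofK f) => x /= h1 _.
by change (- (Lspace_of f : T -> R) x = - f x); rewrite h1.
Qed.

Let scaleE a (f : LfunType mu p1) :
  Lspace_scale a (Lspace_of f) = Lspace_of (a *: f).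
Proof.
apply/Lspace_ofP; apply: filterS (Lspace_ofK f) => x /= h1 _.
by change (a * (Lspace_of f : T -> R) x = a * f x); rewrite h1.
Qed.

Let addA : associative Lspace_add.
Proof.
by move=> u v w; rewrite -(Lfun_ofK u) -(Lfun_ofK v) -(Lfun_ofK w) !addE addrA.
Qed.

Let addC : commutative Lspace_add.
Proof. by move=> u v; rewrite /Lspace_add addrC. Qed.

Let add0 : left_id Lspace_zero Lspace_add.
Proof. by move=> u; rewrite -(Lfun_ofK u) addE add0r. Qed.

Let addN : left_inverse Lspace_zero Lspace_opp Lspace_add.
Proof. by move=> u; rewrite -(Lfun_ofK u) oppE addE addNr. Qed.

HB.instance Definition _ := GRing.isZmodule.Build (LspaceType mu p1)
  addA addC add0 addN.

Let scaleA a b u : Lspace_scale a (Lspace_scale b u) = Lspace_scale (a * b) u.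
Proof. by rewrite -(Lfun_ofK u) !scaleE scalerA. Qed.

Let scale1 : left_id 1 Lspace_scale.
Proof. by move=> u; rewrite -(Lfun_ofK u) scaleE scale1r. Qed.

Let scaleDr : right_distributive Lspace_scale +%R.
Proof.
move=> a u v; rewrite -(Lfun_ofK u) -(Lfun_ofK v).
by rewrite /GRing.add/= addE !scaleE addE scalerDr.
Qed.

Let scaleDl v : {morph Lspace_scale^~ v : a b / a + b}.
Proof.
move=> a b; rewrite -(Lfun_ofK v).
by rewrite [RHS]/GRing.add/= !scaleE addE scalerDl.
Qed.

HB.instance Definition _ := GRing.Zmodule_isLmodule.Build R (LspaceType mu p1)
  scaleA scale1 scaleDr scaleDl.

Lemma Lspace_of_is_linear : linear Lspace_of.
Proof.
move=> a f g.
by transitivity (Lspace_add (Lspace_scale a (Lspace_of f)) (Lspace_of g));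
  [rewrite scaleE addE|].
Qed.

HB.instance Definition _ := GRing.isLinear.Build R (LfunType mu p1)
  (LspaceType mu p1) _ Lspace_of Lspace_of_is_linear.

Lemma Lspace_linE (a : R) (u v : LspaceType mu p1) :
  ((a *: u + v : LspaceType mu p1) : T -> R)
    = (fun x => a * (u : T -> R) x + (v : T -> R) x) %[ae mu].
Proof.
have -> : a *: u + v = Lspace_of (a *: Lfun_of u + Lfun_of v).
  by rewrite Lspace_of_is_linear !Lfun_ofK.
exact: Lspace_ofK.
Qed.

End Lspace_ae.

Section probability_space_hypotheses.
Context d (T : measurableType d) (R : realType).

(* [T] is Borel isomorphic to a Polish space. A Hausdorff pseudometric space is
   a metric space, and for it second countability is separability. *)
Definition standard_borel : Prop :=
  exists (P : completePseudoMetricType R) (h : T -> P),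
    [/\ hausdorff_space P, @second_countable P, bijective h &
        forall A : set T, measurable A <-> <<s [set U : set P | open U] >> (h @` A)].

Definition atomless (mu : {measure set T -> \bar R}) : Prop :=
  forall A, measurable A -> (0 < mu A)%E ->
    exists B, [/\ measurable B, B `<=` A & (0 < mu B < mu A)%E].

End probability_space_hypotheses.
Arguments standard_borel {d} T R.

Section graphon.
Context d (T : measurableType d) (R : realType).

Record graphon := Graphon {
  graphon_fun :> T * T -> R;
  graphon_measurable : measurable_fun setT graphon_fun;
  graphon_sym : forall x y, graphon_fun (x, y) = graphon_fun (y, x);
  graphon_itv : forall z, 0 <= graphon_fun z <= 1
}.

Variable nu : probability T R.

Definition bipartite (W : graphon) : Prop :=
  exists A B : set T,
    [/\ measurable A, measurable B, A `|` B = setT, A `&` B = set0 &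
        {ae (nu \x nu)%E, forall z, (A `*` A) z -> W z = 0} /\
        {ae (nu \x nu)%E, forall z, (B `*` B) z -> W z = 0}].

End graphon.
Arguments graphon {d} T R.

Section kernel_operator.
Context d (T : measurableType d) (R : realType) (nu : probability T R).
Variable W : graphon T R.

Definition kernel_integral (f : T -> R) (x : T) : R :=
  \int[nu]_y (W (x, y) * f y).

Let mW : measurable_fun setT W := graphon_measurable W.

Let W1 z (a : R) : `|W z * a| <= `|a|.
Proof.
have /andP[W0 W1] := graphon_itv W z.
by rewrite normrM (ger0_norm W0) ler_piMl.
Qed.

Let Lfun21 f : f \in Lfun nu 2%:E -> nu.-integrable setT (EFin \o f).
Proof.
move=> f2; apply/Lfun1_integrable; apply: Lfun_subset12 f2.
exact: fin_num_measure.
Qed.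

Let mf f : f \in Lfun nu 2%:E -> measurable_fun setT f.
Proof. by move=> /andP[+ _]; rewrite inE. Qed.

Lemma kernel_integrable f x : f \in Lfun nu 2%:E ->
  nu.-integrable setT (EFin \o (fun y => W (x, y) * f y)).
Proof.
move=> f2; apply: (le_integrable _ _ _ (Lfun21 f2)) => //.
  apply/measurable_EFinP; apply: measurable_funM; last exact: mf.
  exact: (measurableT_comp mW).
by move=> y _; rewrite /= lee_fin W1.
Qed.

Let measurable_kernel_integral f : f \in Lfun nu 2%:E ->
  measurable_fun setT (kernel_integral f).
Proof.
move=> f2.
pose g (z : T * T) : \bar R := (W z * f z.2)%:E.
have mg : measurable_fun setT g.
  apply/measurable_EFinP; apply: measurable_funM => //.
  by apply: measurableT_comp; [exact: mf|exact: measurable_snd].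
have ig : (nu \x nu)%E.-integrable setT g.
  apply/integrable21ltyP => //.
  have /integrableP[mf1 fi] := Lfun21 f2.
  apply: le_lt_trans fi; apply: ge0_le_integral => //.
  - by move=> y _; exact: integral_ge0.
  - apply: (measurable_fun_fubini_tonelli_G (abse \o g)) => //=.
    exact: measurableT_comp.
  - exact: measurableT_comp.
  - move=> y _; rewrite -[leRHS](mule1) -(@probability_setT _ _ _ nu).
    rewrite -integral_cst//; apply: ge0_le_integral => //.
    + apply: measurableT_comp => //; exact: (measurableT_comp mg).
    + by move=> x _; rewrite /= lee_fin W1.
apply: (measurableT_comp (f := fine) (T2 := \bar R)) => //.
exact: (measurable_fubini_F ig).
Qed.

Lemma kernel_integral_L2 f : f \in Lfun nu 2%:E ->
  kernel_integral f \in Lfun nu 2%:E.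
Proof.
move=> f2; have mk := measurable_kernel_integral f2.
apply/andP; split; rewrite inE//=.
pose c := \int[nu]_y `|f y|.
have kc x : `|kernel_integral f x| <= c.
  apply: le_trans (le_normr_Rintegral _ (kernel_integrable x f2)) _ => //.
  apply: le_Rintegral => //.
  - by have /integrable_norm := kernel_integrable x f2.
  - by have /integrable_norm := Lfun21 f2.
have : cst c \in Lfun nu 2%:E := Lfun_cst _ _ _.
move=> /andP[_]; rewrite inE/= /finite_norm.
apply: le_lt_trans; rewrite Lnorm.unlock.
have mpow (g : T -> R) : measurable_fun setT g ->
    @measurable_fun _ _ T (\bar R) setT (fun x => `|(EFin \o g) x| `^ 2%R)%E.
  move=> mg; apply/measurable_EFinP.
  apply: (measurableT_comp (f := fun x : R => x `^ 2)) => //.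
  exact: measurableT_comp.
apply: gt0_ler_poweR.
- by rewrite invr_ge0.
- by rewrite in_itv/= leey andbT integral_ge0// => x _; rewrite lee_fin powR_ge0.
- by rewrite in_itv/= leey andbT integral_ge0// => x _; rewrite lee_fin powR_ge0.
apply: ge0_le_integral; [by []|by move=> x _; exact: poweR_ge0|exact: mpow|
  exact: mpow|].
move=> x _; rewrite /= lee_fin ge0_ler_powR// ?nnegrE//.
by rewrite (le_trans (kc x))// ler_norm.
Qed.

Definition kernel_op (u : LspaceType2 nu) : LspaceType2 nu :=
  Lspace_of (Lfun_Sub (lee1n 2) (kernel_integral_L2 (Lfun_of_subproof u))).

Lemma kernel_opE (u : LspaceType2 nu) :
  (kernel_op u : T -> R) = kernel_integral u %[ae nu].
Proof. exact: Lspace_ofK. Qed.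

Lemma kernel_integral_ae (f g : T -> R) x :
  f \in Lfun nu 2%:E -> g \in Lfun nu 2%:E -> f = g %[ae nu] ->
  kernel_integral f x = kernel_integral g x.
Proof.
move=> f2 g2 fg; congr fine; apply: ae_eq_integral.
- exact: measurableT.
- exact: measurable_int (kernel_integrable x f2).
- exact: measurable_int (kernel_integrable x g2).
- by apply: filterS fg => y fgy /fgy; move: (f y) (g y) => ? ? ->.
Qed.

Lemma kernel_integral_lin (a : R) (f g : T -> R) x :
  f \in Lfun nu 2%:E -> g \in Lfun nu 2%:E ->
  kernel_integral (fun y => a * f y + g y) x
    = a * kernel_integral f x + kernel_integral g x.
Proof.
move=> f2 g2.
have ig := kernel_integrable x g2.
have iaf : nu.-integrable setT (EFin \o (fun y => a * (W (x, y) * f y))).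
  by have := integrableZl measurableT a (kernel_integrable x f2).
rewrite /kernel_integral -RintegralZl//; last exact: kernel_integrable.
rewrite -RintegralD//.
by apply: eq_Rintegral => y _; rewrite mulrDr mulrCA.
Qed.

Lemma kernel_op_is_linear : linear kernel_op.
Proof.
move=> a u v; rewrite /kernel_op -Lspace_of_is_linear; apply/Lspace_ofP.
apply: aeW => x _.
pose w := Lfun_Sub (lee1n 2) (Lfun_of_subproof u).
pose z := Lfun_Sub (lee1n 2) (Lfun_of_subproof v).
apply: etrans (kernel_integral_ae x _ (LfunP (a *: w + z))
  (Lspace_linE a u v)) _; first exact: Lfun_of_subproof.
exact: (kernel_integral_lin a x (Lfun_of_subproof u) (Lfun_of_subproof v)).
Qed.

HB.instance Definition _ := GRing.isLinear.Build R (LspaceType2 nu)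
  (LspaceType2 nu) _ kernel_op kernel_op_is_linear.

End kernel_operator.
Arguments kernel_op {d T R} nu W u.

Section spectrum.
Context (R : realType) (V : lmodType R).

Definition linearly_independent n (v : 'I_n -> V) : Prop :=
  forall c : 'I_n -> R, \sum_i c i *: v i = 0 -> forall i, c i = 0.

(* Meant for a linear subspace [S]; the value is [+oo] when [S] contains
   arbitrarily large finite independent families. *)
Definition dimension (S : set V) : \bar R :=
  ereal_sup [set n%:R%:E | n in
    [set n | exists v : 'I_n -> V, range v `<=` S /\ linearly_independent v]].

Variable A : {linear V -> V}.

Definition is_eigenvalue (l : R) : Prop := exists2 u : V, u != 0 & A u = l *: u.

Definition multiplicity (l : R) : \bar R := dimension [set u | A u = l *: u].

Definition symmetric_spectrum : Prop :=
  forall l, (is_eigenvalue l <-> is_eigenvalue (- l)) /\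
            multiplicity l = multiplicity (- l).

End spectrum.

(* Main.v *)
From HB Require Import structures.
Require Import Defs.
From mathcomp Require Import all_boot all_order all_algebra.
From mathcomp Require Import all_classical all_reals all_analysis.
From mathcomp Require Import measurable_realfun ess_sup_inf ring lra.

(* The flip f |-> (1_A - 1_B) f anticommutes with T_W when A and B witness
   bipartiteness, which gives the easy direction.

   Conversely, call a disjoint pair (A, B) bipartite if W(x, .) vanishes a.e.
   outside B for a.e. x in A, and vice versa; A u B is then, up to null sets, a
   union of connected components. By exhaustion there is such a pair with A u B of
   maximal measure; let S be its complement. If W is not null on S x S, the
   operator of the restriction of W to S has its norm l as an eigenvalue. The flip
   maps the (-l)-eigenfunctions of T_W supported on A u B to l-eigenfunctions
   supported there, so, multiplicities being finite, equality of the multiplicities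
   of l and -l provides a (-l)-eigenfunction u that does not vanish on S; cut it
   down to S. Since l is the norm, |u| is an l-eigenfunction, and comparing
   T u = - l u with T|u| = l |u| shows that ({u > 0}, {u < 0}) is a bipartite pair
   in S, contradicting maximality. Hence W is null on S x S.

   The existence of the top eigenvalue uses no compactness: with s = l^2 and
   c_n = <T^n 1, 1>, log-convexity of n |-> |T^n f|^2 and W <= 1 give
   c_(2n) >= s^(n+1), so the sequence T^(2n) 1 / s^n, whose norms decrease, does
   not tend to 0; it is Cauchy in L^2, and its image under T is uniformly Cauchy. *)

Set Implicit Arguments.
Unset Strict Implicit.
Unset Printing Implicit Defensive.

Import Order.TTheory GRing.Theory Num.Theory.
Import numFieldNormedType.Exports.

Local Open Scope classical_set_scope.
Local Open Scope ring_scope.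

(** * Bounded measurable functions *)

Section bounded_measurable.
Context d (T : measurableType d) (R : realType) (nu : probability T R).
Implicit Types f g h : T -> R.

(** The bound holds at every point, not just almost everywhere. By [bmfunK_Lfun2] the operator T
    sends all of L2 into this class, so an eigenvector for a nonzero eigenvalue has a representative
    in it and the analysis can run on functions instead of classes. *)
Definition bmfun f := measurable_fun setT f /\ exists M, forall x, `|f x| <= M.

Lemma bmfun_cst (c : R) : bmfun (cst c).
Proof. by split; [exact: measurable_cst|exists `|c|]. Qed.

Lemma bmfunD f g : bmfun f -> bmfun g -> bmfun (fun x => f x + g x).
Proof.
move=> [mf [M fM]] [mg [N gN]]; split; first exact: measurable_funD.
by exists (M + N) => x; rewrite (le_trans (ler_normD _ _))// lerD.
Qed.

Lemma bmfunM f g : bmfun f -> bmfun g -> bmfun (fun x => f x * g x).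
Proof.
move=> [mf [M fM]] [mg [N gN]]; split; first exact: measurable_funM.
by exists (M * N) => x; rewrite normrM ler_pM.
Qed.

Lemma bmfunZ (a : R) f : bmfun f -> bmfun (fun x => a * f x).
Proof. by move=> bf; apply: (bmfunM (bmfun_cst a) bf). Qed.

Lemma bmfunN f : bmfun f -> bmfun (fun x => - f x).
Proof.
by move=> [mf [M fM]]; split; [exact: measurableT_comp|exists M => x; rewrite normrN].
Qed.

Lemma bmfunB f g : bmfun f -> bmfun g -> bmfun (fun x => f x - g x).
Proof. by move=> bf bg; exact: (bmfunD bf (bmfunN bg)). Qed.

Lemma bmfun_norm f : bmfun f -> bmfun (fun x => `|f x|).
Proof.
by move=> [mf [M fM]]; split; [exact: measurableT_comp|exists M => x; rewrite normr_id].
Qed.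

Lemma bmfun_indic (A : set T) : measurable A -> bmfun \1_A.
Proof.
move=> mA; split; first exact: measurable_indic.
by exists 1 => x; rewrite indicE; case: (_ \in _); rewrite ?normr1 ?normr0.
Qed.

Lemma bmfun_sum n (f : 'I_n -> T -> R) :
  (forall i, bmfun (f i)) -> bmfun (fun x => \sum_i f i x).
Proof.
move=> bf; elim: n f bf => [|n IH] f bf.
  by under eq_fun do rewrite big_ord0; exact: (bmfun_cst 0).
by under eq_fun do rewrite big_ord_recr/=; apply: bmfunD => //; exact: IH.
Qed.

Lemma bmfun_integrable f : bmfun f -> nu.-integrable setT (EFin \o f).
Proof.
move=> [mf [M fM]]; apply: measurable_bounded_integrable => //.
  exact: fin_num_fun_lty.
exists M; split; first exact: num_real.
by move=> y My x _ /=; rewrite (le_trans (fM x))// ltW.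
Qed.

Lemma bmfun_Lfun2 f : bmfun f -> f \in Lfun nu 2%:E.
Proof.
move=> [mf [M fM]]; rewrite inE/=; apply/andP; split; rewrite inE//=.
rewrite /finite_norm unlock poweR_lty//.
apply: (@le_lt_trans _ _ (\int[nu]_x (cst (`|M| `^ 2)%:E x))%E).
  apply: ge0_le_integral => //.
  - by move=> x _; exact: poweR_ge0.
  - apply/measurable_EFinP.
    apply: (measurableT_comp (f := fun x : R => x `^ 2)) => //.
    exact: measurableT_comp.
  - move=> x _; rewrite /= lee_fin ge0_ler_powR// ?nnegrE//.
    exact: le_trans (fM x) (ler_norm M).
by rewrite integral_cst// [X in (_ * X)%E](_ : _ = 1%E) ?mule1 ?ltry//; exact: probability_setT.
Qed.

Definition ip f g : R := \int[nu]_x (f x * g x).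

Lemma ipC f g : ip f g = ip g f.
Proof. by apply: eq_Rintegral => x _; rewrite mulrC. Qed.

Lemma ipDl f g h : bmfun f -> bmfun g -> bmfun h ->
  ip (fun x => f x + g x) h = ip f h + ip g h.
Proof.
move=> bf bg bh; rewrite /ip -RintegralD//; try exact/bmfun_integrable/bmfunM.
by apply: eq_Rintegral => x _; rewrite mulrDl.
Qed.

Lemma ipZl (a : R) f h : bmfun f -> bmfun h -> ip (fun x => a * f x) h = a * ip f h.
Proof.
move=> bf bh; rewrite /ip -RintegralZl//; last exact/bmfun_integrable/bmfunM.
by apply: eq_Rintegral => x _; rewrite mulrA.
Qed.

Lemma ip_ge0 f : 0 <= ip f f.
Proof. by apply: Rintegral_ge0 => x _; rewrite -expr2 sqr_ge0. Qed.

Lemma ipBl f g h : bmfun f -> bmfun g -> bmfun h ->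
  ip (fun x => f x - g x) h = ip f h - ip g h.
Proof.
move=> bf bg bh; rewrite /ip -RintegralB//; try exact/bmfun_integrable/bmfunM.
by apply: eq_Rintegral => x _; rewrite mulrBl.
Qed.

Lemma ip_suml n (f : 'I_n -> T -> R) g : (forall i, bmfun (f i)) -> bmfun g ->
  ip (fun x => \sum_i f i x) g = \sum_i ip (f i) g.
Proof.
move=> + bg; elim: n f => [|n IH] f bf.
  rewrite big_ord0 /ip -[RHS](mul0r (fine (nu setT))) -Rintegral_cst//.
  by apply: eq_Rintegral => x _; rewrite big_ord0 mul0r.
rewrite big_ord_recr/= -IH// -ipDl//; last exact: bmfun_sum.
by apply: eq_Rintegral => x _; rewrite big_ord_recr.
Qed.

Lemma le_ip f g f' g' : bmfun f -> bmfun g -> bmfun f' -> bmfun g' ->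
  (forall x, f x * g x <= f' x * g' x) -> ip f g <= ip f' g'.
Proof. by move=> *; apply: le_Rintegral => //; exact/bmfun_integrable/bmfunM. Qed.

Lemma sqrB_ip (a : R) f g : bmfun f -> bmfun g ->
  ip (fun x => f x - a * g x) (fun x => f x - a * g x)
  = ip f f - a * ip f g *+ 2 + a ^+ 2 * ip g g.
Proof.
move=> bf bg; have bag := bmfunZ a bg; have bfag := bmfunB bf bag.
rewrite ipBl// ipZl// !(ipC _ (fun x => f x - a * g x)) !ipBl// !ipZl//.
by rewrite (ipC g f); ring.
Qed.

Lemma cauchy_schwarz f g : bmfun f -> bmfun g -> ip f g ^+ 2 <= ip f f * ip g g.
Proof.
move=> bf bg; have := ip_ge0 g; rewrite le_eqVlt => /predU1P[g0|g0].
  rewrite -g0 mulr0; have [->|fg0] := eqVneq (ip f g) 0; first by rewrite expr0n.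
  (* Here |g| = 0, so |f - a g|^2 = |f|^2 - 2 a <f, g> is affine in a; this choice of a gives the
     value -|f|^2 - 2 < 0. *)
  have := ip_ge0 (fun x => f x - ((ip f f + 1) / ip f g) * g x).
  rewrite sqrB_ip// -g0 mulr0 addr0 divfK// => H.
  by exfalso; move: H (ip_ge0 f); lra.
have := ip_ge0 (fun x => f x - (ip f g / ip g g) * g x); rewrite sqrB_ip//.
have -> : ip f f - (ip f g / ip g g * ip f g) *+ 2 +
  (ip f g / ip g g) ^+ 2 * ip g g = (ip f f * ip g g - ip f g ^+ 2) / ip g g.
  by field; rewrite gt_eqF.
by rewrite pmulr_lge0 ?invr_gt0// subr_ge0.
Qed.

Lemma ip1 : ip (cst 1) (cst 1) = 1.
Proof.
rewrite /ip; under eq_Rintegral do rewrite mulr1.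
rewrite Rintegral_cst// mul1r; exact: (congr1 fine (probability_setT nu)).
Qed.

Lemma sqr_Rintegral_le f : bmfun f -> (\int[nu]_x `|f x|) ^+ 2 <= ip f f.
Proof.
move=> bf; have -> : \int[nu]_x `|f x| = ip (fun x => `|f x|) (cst 1).
  by apply: eq_Rintegral => x _; rewrite mulr1.
have -> : ip f f = ip (fun x => `|f x|) (fun x => `|f x|).
  by apply: eq_Rintegral => x _; rewrite -normrM -expr2 ger0_norm// sqr_ge0.
by have := cauchy_schwarz (bmfun_norm bf) (bmfun_cst 1); rewrite ip1 mulr1.
Qed.

Lemma ae0_ge0_Rintegral f : bmfun f -> (forall x, 0 <= f x) ->
  \int[nu]_x f x = 0 -> {ae nu, forall x, f x = 0}.
Proof.
move=> bf f0 fI.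
have mf : measurable_fun setT (EFin \o f) by case: bf => mf _; exact/measurable_EFinP.
have /(ae_eq_integral_abs nu measurableT mf) : (\int[nu]_(x in setT) `|(EFin \o f) x| = 0)%E.
  under eq_integral do rewrite /= ger0_norm//.
  by rewrite -[LHS]fineK ?[fine _]fI//; exact: integrable_fin_num (bmfun_integrable bf).
by apply: filterS => x /(_ I) [].
Qed.

Lemma bounded_Rintegral_cvg (h : nat -> T -> R) f M :
  (forall n, bmfun (h n)) -> bmfun f -> (forall n x, `|h n x| <= M) ->
  (forall x, h ^~ x @ \oo --> f x) ->
  (fun n => \int[nu]_x h n x) @ \oo --> \int[nu]_x f x.
Proof.
move=> bh bf hM hf.
have [|||_ _] := @dominated_convergence _ _ _ nu setT measurableT
    (fun n => EFin \o h n) (EFin \o f) (EFin \o cst M)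
    (fun n => measurable_int _ (bmfun_integrable (bh n)))
    (measurable_int _ (bmfun_integrable bf)).
- apply: aeW => y _; apply: cvg_EFin; first exact: nearW.
  exact: hf.
- exact/bmfun_integrable/bmfun_cst.
- by apply: aeW => y n _; rewrite /= lee_fin hM.
have E g : bmfun g -> (\int[nu]_y (g y)%:E)%E = (\int[nu]_x g x)%:E.
  by move=> bg; rewrite fineK//; apply: integrable_fin_num => //; exact: bmfun_integrable.
rewrite E//; under eq_fun do rewrite E//.
by move=> /fine_cvgP[].
Qed.

End bounded_measurable.

(** * The kernel operator on bounded functions *)

Section kernel_bounded.
Context d (T : measurableType d) (R : realType) (nu : probability T R).
Variable W : graphon T R.
Implicit Types f g h : T -> R.
Local Notation K := (kernel_integral nu W).
Local Notation ip := (ip nu).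

Lemma graphon_ge0 z : 0 <= W z.
Proof. by have /andP[] := graphon_itv W z. Qed.

Lemma graphon_le1 z : W z <= 1.
Proof. by have /andP[] := graphon_itv W z. Qed.

Lemma bmfun_graphon x : bmfun (fun y => W (x, y)).
Proof.
split; first exact: (measurableT_comp (graphon_measurable W)).
by exists 1 => y; rewrite ger0_norm ?graphon_ge0// graphon_le1.
Qed.

Lemma Lfun2_norm_integrable f :
  f \in Lfun nu 2%:E -> nu.-integrable setT (EFin \o (fun x => `|f x|)).
Proof.
move=> f2; have : nu.-integrable setT (EFin \o f).
  by apply/Lfun1_integrable; apply: Lfun_subset12 f2; exact: fin_num_measure.
exact: integrable_norm.
Qed.

Lemma K_norm_le f x : f \in Lfun nu 2%:E -> `|K f x| <= \int[nu]_y `|f y|.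
Proof.
move=> f2; apply: le_trans (le_normr_Rintegral _ (kernel_integrable W x f2)) _ => //.
apply: le_Rintegral => //.
- by have /integrable_norm := kernel_integrable W x f2.
- exact: Lfun2_norm_integrable.
- by move=> y _; rewrite normrM ger0_norm ?graphon_ge0// ler_piMl// graphon_le1.
Qed.

Lemma bmfunK_Lfun2 f : f \in Lfun nu 2%:E -> bmfun (K f).
Proof.
move=> f2; split; last by exists (\int[nu]_y `|f y|) => x; exact: K_norm_le.
by have /andP[+ _] := kernel_integral_L2 W f2; rewrite inE.
Qed.

Lemma bmfunK f : bmfun f -> bmfun (K f).
Proof. by move=> bf; exact/bmfunK_Lfun2/bmfun_Lfun2. Qed.

Lemma bmfun_iterK n f : bmfun f -> bmfun (iter n K f).
Proof. by move=> bf; elim: n => //= n; exact: bmfunK. Qed.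

Lemma le_K f g x : bmfun f -> bmfun g -> (forall y, f y <= g y) -> K f x <= K g x.
Proof.
move=> bf bg fg; apply: le_Rintegral => //.
- exact/kernel_integrable/bmfun_Lfun2.
- exact/kernel_integrable/bmfun_Lfun2.
- by move=> y _; rewrite ler_wpM2l// graphon_ge0.
Qed.

Lemma K_ge0 f x : (forall y, 0 <= f y) -> 0 <= K f x.
Proof. by move=> f0; apply: Rintegral_ge0 => y _; rewrite mulr_ge0// graphon_ge0. Qed.

Lemma KZ (a : R) f x : bmfun f -> K (fun y => a * f y) x = a * K f x.
Proof.
move=> bf; rewrite /kernel_integral -RintegralZl//; last exact/kernel_integrable/bmfun_Lfun2.
by apply: eq_Rintegral => y _; rewrite mulrCA.
Qed.

Lemma KD f g x : bmfun f -> bmfun g -> K (fun y => f y + g y) x = K f x + K g x.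
Proof.
move=> bf bg; rewrite /kernel_integral -RintegralD//; try exact/kernel_integrable/bmfun_Lfun2.
by apply: eq_Rintegral => y _; rewrite mulrDr.
Qed.

Lemma KB f g x : bmfun f -> bmfun g -> K (fun y => f y - g y) x = K f x - K g x.
Proof.
move=> bf bg; rewrite KD//; last exact: bmfunN.
by rewrite -(mulN1r (K g x)) -KZ//; congr (_ + K _ _); apply/funext => y; rewrite mulN1r.
Qed.

Lemma K_sum n (f : 'I_n -> T -> R) x : (forall i, bmfun (f i)) ->
  K (fun y => \sum_i f i y) x = \sum_i K (f i) x.
Proof.
elim: n f => [|n IH] f bf.
  rewrite big_ord0 -[RHS](mul0r (K (cst 0) x)) -KZ; last exact: bmfun_cst.
  by congr K; apply/funext => y; rewrite big_ord0 mul0r.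
rewrite big_ord_recr/= -IH// -KD//; last exact: bmfun_sum.
by congr K; apply/funext => y; rewrite big_ord_recr.
Qed.

Lemma norm_K_le f x : bmfun f -> `|K f x| <= K (fun y => `|f y|) x.
Proof.
move=> bf; rewrite ler_norml -(mulN1r (K _ x)) -KZ; last exact: bmfun_norm.
apply/andP; split; apply: le_K => //.
- exact/bmfunZ/bmfun_norm.
- by move=> y; rewrite mulN1r lerNl -normrN ler_norm.
- exact: bmfun_norm.
- by move=> y; exact: ler_norm.
Qed.

(** Combines W <= 1 with Cauchy-Schwarz against the constant 1. The bound being pointwise, T turns
    an L2-Cauchy sequence into a uniformly Cauchy one; it also yields the Bessel bound behind finite
    multiplicities. *)
Lemma sqr_K_le f x : bmfun f -> K f x ^+ 2 <= ip f f.
Proof.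
move=> bf; apply: le_trans (sqr_Rintegral_le nu bf).
have f0 : 0 <= \int[nu]_y `|f y| by apply: Rintegral_ge0.
have := K_norm_le x (bmfun_Lfun2 nu bf).
by rewrite -[K f x ^+ 2]real_normK ?num_real// ler_sqr// nnegrE.
Qed.

Lemma ip_K_le f : bmfun f -> ip (K f) (K f) <= ip f f.
Proof.
move=> bf; apply: (@le_trans _ _ (\int[nu]_x (cst (ip f f) x))).
  apply: le_Rintegral => //.
  - by apply/bmfun_integrable/bmfunM; exact: bmfunK.
  - exact/bmfun_integrable/bmfun_cst.
  - by move=> x _; rewrite -expr2 sqr_K_le.
by rewrite Rintegral_cst// (congr1 fine (probability_setT nu)) mulr1.
Qed.

Lemma Rintegral_swap (F : T * T -> R) : bmfun F ->
  \int[nu]_x \int[nu]_y F (x, y) = \int[nu]_y \int[nu]_x F (x, y).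
Proof.
move=> bF.
have bx x : bmfun (fun y => F (x, y)).
  by case: bF => mF [M FM]; split; [exact: measurableT_comp|exists M].
have by_ y : bmfun (fun x => F (x, y)).
  by case: bF => mF [M FM]; split; [exact: measurableT_comp|exists M].
have E g : bmfun g -> (\int[nu]_y g y)%:E = (\int[nu]_y (g y)%:E)%E.
  by move=> bg; rewrite fineK//; apply: integrable_fin_num => //; exact: bmfun_integrable.
congr fine; under eq_integral do rewrite E//.
under [RHS]eq_integral do rewrite E//.
exact: (Fubini (bmfun_integrable (nu \x nu)%E bF)).
Qed.

Lemma K_sym f g : bmfun f -> bmfun g -> ip (K f) g = ip f (K g).
Proof.
move=> bf bg.
have bW : bmfun W.
  split; first exact: graphon_measurable.
  by exists 1 => z; rewrite ger0_norm ?graphon_ge0// graphon_le1.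
have bF : bmfun (fun z => W z * f z.2 * g z.1).
  apply: bmfunM; first apply: bmfunM => //.
  - by case: bf => mf [M fM]; split; [exact: measurableT_comp|exists M].
  - by case: bg => mf [M fM]; split; [exact: measurableT_comp|exists M].
transitivity (\int[nu]_x \int[nu]_y (W (x, y) * f y * g x)).
  apply: eq_Rintegral => x _; rewrite -RintegralZr//.
  exact/kernel_integrable/bmfun_Lfun2.
rewrite (Rintegral_swap bF); apply: eq_Rintegral => y _ /=.
rewrite -RintegralZl//; last exact/kernel_integrable/bmfun_Lfun2.
by apply: eq_Rintegral => x _; rewrite (graphon_sym W x y); ring.
Qed.

Lemma ip_iterK m n f g : bmfun f -> bmfun g ->
  ip (iter m K f) (iter n K g) = ip (iter (m + n) K f) g.
Proof.
move=> bf bg; elim: n m => [|n IH] m; first by rewrite addn0.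
rewrite /= -K_sym; [|exact: bmfun_iterK..].
by rewrite addnS -addSn; exact: (IH m.+1).
Qed.

Lemma K_cvg (h : nat -> T -> R) (f : T -> R) M : (forall n, bmfun (h n)) -> bmfun f ->
  (forall n x, `|h n x| <= M) -> (forall x, h ^~ x @ \oo --> f x) ->
  forall x, (fun n => K (h n) x) @ \oo --> K f x.
Proof.
move=> bh bf hM hf x; apply: (@bounded_Rintegral_cvg _ _ _ _ _ _ M).
- by move=> n; apply: bmfunM => //; exact: bmfun_graphon.
- by apply: bmfunM => //; exact: bmfun_graphon.
- move=> n y; rewrite normrM ger0_norm ?graphon_ge0//.
  by apply: le_trans (hM n y); rewrite ler_piMl// graphon_le1.
- by move=> y; apply: cvgM; [exact: cvg_cst|exact: hf].
Qed.

End kernel_bounded.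

(** * The top eigenvalue, by power iteration *)

Section log_convex.
Context (R : realType) (a : nat -> R).
Hypothesis a0 : forall n, 0 <= a n.
Hypothesis a_convex : forall n, a n.+1 ^+ 2 <= a n * a n.+2.

(** The ratios a_(n+1) / a_n are nondecreasing, hence at least a_1 / a_0. The form without division
    covers vanishing terms: a_n = 0 forces a_(n+1) = 0. *)
Lemma log_convex_ratio n : a 1 * a n <= a 0 * a n.+1.
Proof.
elim: n => [|n IH]; first by rewrite mulrC.
have := a0 n; rewrite le_eqVlt => /predU1P[an0|an0].
  have -> : a n.+1 = 0.
    by apply/eqP; rewrite -sqrf_eq0 eq_le sqr_ge0 (le_trans (a_convex n))// -an0 mul0r.
  by rewrite mulr0 mulr_ge0.
(* After multiplication by a_n, the claim follows from the induction hypothesis times a_(n+1) and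
   convexity times a_0. *)
rewrite -(ler_pM2r an0).
have := a_convex n; have := a0 n.+1; have := a0 0; nra.
Qed.

Lemma log_convex_geometric n : a 1 ^+ n.+1 <= a 0 ^+ n * a n.+1.
Proof.
elim: n => [|n IH]; first by rewrite mul1r.
rewrite exprS (le_trans (ler_wpM2l (a0 1) IH))// mulrCA exprSr -mulrA.
by rewrite ler_wpM2l ?exprn_ge0// log_convex_ratio.
Qed.

End log_convex.

(** * The operator norm and the moments of T *)

Section top_eigenvalue.
Context d (T : measurableType d) (R : realType) (nu : probability T R).
Variable W : graphon T R.
Implicit Types f g h : T -> R.
Local Notation K := (kernel_integral nu W).
Local Notation ip := (ip nu).

(** By symmetry of T, |T^(n+1) f|^2 = <T^n f, T^(n+2) f>, and Cauchy-Schwarz applies. *)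
Lemma ip_K_log_convex f n : bmfun f ->
  ip (iter n.+1 K f) (iter n.+1 K f) ^+ 2 <=
  ip (iter n K f) (iter n K f) * ip (iter n.+2 K f) (iter n.+2 K f).
Proof.
move=> bf.
have -> : ip (iter n.+1 K f) (iter n.+1 K f) = ip (iter n K f) (iter n.+2 K f).
  by rewrite !ip_iterK// addSnnS.
by apply: cauchy_schwarz; exact: bmfun_iterK.
Qed.

Local Notation c n := (ip (iter n K (cst 1)) (cst 1)).

Lemma moment_ge0 n : 0 <= c n.
Proof.
apply: Rintegral_ge0 => x _; rewrite mulr1; elim: n x => // n IH x.
exact: K_ge0.
Qed.

Lemma iterK_ge0 n x : 0 <= iter n K (cst 1) x.
Proof. by elim: n x => // n IH x; exact: K_ge0. Qed.

(* W <= 1 is used for the innermost and the outermost of the n + 2 factors. *)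
Lemma norm_iterK_le f n x : bmfun f ->
  `|iter n.+2 K f x| <= (\int[nu]_y `|f y|) * c n.
Proof.
move=> bf; have bKf := bmfunK nu W bf.
have f1 : 0 <= \int[nu]_y `|f y| by exact: Rintegral_ge0.
have b1 m : bmfun (iter m K (cst 1)) by apply: bmfun_iterK; exact: bmfun_cst.
have H m y : `|iter m K (K f) y| <= (\int[nu]_y `|f y|) * iter m K (cst 1) y.
  elim: m y => [|m IH] y; first by rewrite mulr1 K_norm_le// bmfun_Lfun2.
  rewrite /= -KZ//; apply: le_trans (norm_K_le nu W y (bmfun_iterK nu W m bKf)) _.
  apply: le_K => //; [exact/bmfun_norm/bmfun_iterK|exact: bmfunZ].
rewrite iterS iterSr.
apply: le_trans (K_norm_le _ _ (bmfun_Lfun2 nu (bmfun_iterK nu W n bKf))) _.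
rewrite /ip -RintegralZl//; last by apply/bmfun_integrable/bmfunM => //; exact: bmfun_cst.
apply: le_Rintegral => //.
- exact/bmfun_integrable/bmfun_norm/bmfun_iterK.
- by apply/bmfun_integrable/bmfunZ/bmfunM => //; exact: bmfun_cst.
- by move=> y _; rewrite mulr1 H.
Qed.

Lemma ip_iterK_le f n : bmfun f ->
  ip (iter n.+2 K f) (iter n.+2 K f) <= ip f f * c n ^+ 2.
Proof.
move=> bf; apply: (@le_trans _ _ (\int[nu]_x (cst (ip f f * c n ^+ 2) x))).
  apply: le_Rintegral => //.
  - by apply/bmfun_integrable/bmfunM; exact: bmfun_iterK.
  - exact/bmfun_integrable/bmfun_cst.
  - move=> x _; rewrite -expr2 -real_normK ?num_real//.
    apply: (@le_trans _ _ (((\int[nu]_y `|f y|) * c n) ^+ 2)).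
      by rewrite ler_sqr ?nnegrE ?norm_iterK_le// mulr_ge0 ?moment_ge0//; exact: Rintegral_ge0.
    by rewrite exprMn ler_wpM2r ?sqr_ge0// sqr_Rintegral_le.
by rewrite Rintegral_cst// (congr1 fine (probability_setT nu)) mulr1.
Qed.

(** The square of the operator norm of T on L2, with the supremum over bounded functions in the unit
    ball. When positive, its square root is the eigenvalue constructed below. *)
Definition K_sqnorm : R := sup [set ip (K f) (K f) | f in [set f | bmfun f /\ ip f f <= 1]].

Let sqnorm_has_sup :
  has_sup [set ip (K f) (K f) | f in [set f | bmfun f /\ ip f f <= 1]].
Proof.
split.
  by exists (ip (K (cst 1)) (K (cst 1))), (cst 1) => //; split; [exact: bmfun_cst|rewrite ip1].
by exists 1 => _ [f [bf f1] <-]; rewrite (le_trans (ip_K_le _ _ bf)).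
Qed.

Lemma K_sqnorm_ge f : bmfun f -> ip f f <= 1 -> ip (K f) (K f) <= K_sqnorm.
Proof. by move=> bf f1; apply: ub_le_sup => //; [case: sqnorm_has_sup|exists f]. Qed.

Lemma K_sqnorm_ge0 : 0 <= K_sqnorm.
Proof.
apply: (le_trans (ip_ge0 nu (K (cst 0)))); apply: K_sqnorm_ge; first exact: bmfun_cst.
by rewrite /ip; under eq_Rintegral do rewrite mulr0; rewrite Rintegral_cst// mul0r.
Qed.

Lemma ip_K_sqnorm f : bmfun f -> ip (K f) (K f) <= K_sqnorm * ip f f.
Proof.
move=> bf; have := ip_ge0 nu f; rewrite le_eqVlt => /predU1P[f0|f0].
  by rewrite -f0 mulr0 f0 ip_K_le.
pose r := (Num.sqrt (ip f f))^-1.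
have r2 : r ^+ 2 = (ip f f)^-1 by rewrite exprVn sqr_sqrtr// ltW.
have brf : bmfun (fun x => r * f x) by exact: bmfunZ.
have := K_sqnorm_ge brf.
have -> : K (fun x => r * f x) = fun x => r * K f x by apply/funext => x; rewrite KZ.
have bK := bmfunK nu W bf.
have E g : bmfun g -> ip (fun x => r * g x) (fun x => r * g x) = ip g g / ip f f.
  move=> bg; rewrite ipZl//; last exact: bmfunZ.
  by rewrite ipC ipZl// mulrA -expr2 r2 mulrC.
rewrite !E// divff ?gt_eqF// => /(_ (lexx _)).
by rewrite ler_pdivrMr.
Qed.

(** For |f| <= 1, log-convexity gives (|T f|^2)^(2n+2) <= |T^(2n+2) f|^2, and [ip_iterK_le] bounds
    the right side by the square of c_(2n). *)
Lemma K_sqnorm_le_moment n : K_sqnorm ^+ n.+1 <= c n.*2.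
Proof.
have n1 : (n.+1%:R : R) != 0 by rewrite pnatr_eq0.
(* The root is moved to the right so that each element of the set defining [K_sqnorm] is bounded
   before the supremum is taken. *)
have H : K_sqnorm <= c n.*2 `^ (n.+1%:R)^-1.
  apply: ge_sup; first by case: sqnorm_has_sup.
  move=> _ [f [bf f1] <-].
  have := @log_convex_geometric _ (fun n => ip (iter n K f) (iter n K f))
    (fun n => ip_ge0 nu _) (fun n => ip_K_log_convex n bf) n.*2.+1.
  rewrite /= => H.
  have {}H : (ip (K f) (K f) ^+ n.+1) ^+ 2 <= c n.*2 ^+ 2.
    rewrite -exprM muln2 doubleS; apply: le_trans H _.
    apply: le_trans (_ : 1 * ip (iter n.*2.+2 K f) (iter n.*2.+2 K f) <= _).
      by rewrite ler_wpM2r ?ip_ge0// exprn_ile1 ?ip_ge0.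
    rewrite mul1r; apply: le_trans (ip_iterK_le _ bf) _.
    by rewrite -[leRHS]mul1r ler_wpM2r ?sqr_ge0.
  move: H; rewrite ler_sqr ?nnegrE ?exprn_ge0 ?ip_ge0 ?moment_ge0// => H.
  rewrite -[leLHS]powRr1 ?ip_ge0// -[X in _ `^ X](mulfV n1) powRrM powR_mulrn ?ip_ge0//.
  by rewrite ge0_ler_powR ?nnegrE ?exprn_ge0 ?ip_ge0 ?moment_ge0.
apply: (@le_trans _ _ ((c n.*2 `^ (n.+1%:R)^-1) ^+ n.+1)).
  by rewrite lerXn2r ?nnegrE ?powR_ge0 ?K_sqnorm_ge0.
by rewrite -powR_mulrn ?powR_ge0// -powRrM mulVf// powRr1 ?moment_ge0.
Qed.

End top_eigenvalue.

(** * Convergence of the power iteration *)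

Section power_iteration.
Context d (T : measurableType d) (R : realType) (nu : probability T R).
Variable W : graphon T R.
Implicit Types f g h : T -> R.
Local Notation K := (kernel_integral nu W).
Local Notation ip := (ip nu).
Local Notation s := (K_sqnorm nu W).
Local Notation c n := (ip (iter n K (cst 1)) (cst 1)).
Hypothesis s0 : 0 < s.

(** Normalised even moments. They do not increase, because c_(2n) = |T^n 1|^2 and s is the squared
    norm of T, and they are at least s by [K_sqnorm_le_moment]; so they converge to a positive
    limit. *)
Let b j := c j.*2 / s ^+ j.

Let sX0 n : 0 < s ^+ n. Proof. exact: exprn_gt0. Qed.

Let bm1 n : bmfun (iter n K (cst 1)).
Proof. by apply: bmfun_iterK; exact: bmfun_cst. Qed.

Let c_double n : c n.*2 = ip (iter n K (cst 1)) (iter n K (cst 1)).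
Proof. by rewrite ip_iterK ?addnn//; exact: bmfun_cst. Qed.

Let b_ge n : s <= b n.
Proof. by rewrite ler_pdivlMr// -exprS K_sqnorm_le_moment. Qed.

Let b_nincr : nonincreasing_seq b.
Proof.
apply/nonincreasing_seqP => n; rewrite /b exprS invfM mulrA.
rewrite ler_pM2r ?invr_gt0// ler_pdivrMr// mulrC !c_double /=.
exact: ip_K_sqnorm.
Qed.

Let b_cvg : cvgn b.
Proof.
apply: nonincreasing_is_cvgn => //; exists s => _ [n _ <-]; exact: b_ge.
Qed.

Let e n x : R := iter n.*2 K (cst 1) x / s ^+ n.

Let bme n : bmfun (e n).
Proof. by apply: bmfunM => //; exact: bmfun_cst. Qed.

(** By symmetry of T the Gram matrix depends on m + n only. Hence |e_m - e_n|^2 is a combination of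
    three values of the convergent sequence [b], and [e] is Cauchy in L2. *)
Let ip_e m n : ip (e m) (e n) = b (m + n).
Proof.
have E k : e k = fun x => (s ^+ k)^-1 * iter k.*2 K (cst 1) x.
  by apply/funext => x; rewrite mulrC.
rewrite [e m]E [e n]E ipZl//; last exact: bmfunZ.
rewrite ipC ipZl// ip_iterK; [|exact: bmfun_cst..].
by rewrite /b exprD invfM doubleD addnC [RHS]mulrC -mulrA.
Qed.

Let KK_e n : K (K (e n)) = fun x => s * e n.+1 x.
Proof.
have E k : e k = fun x => (s ^+ k)^-1 * iter k.*2 K (cst 1) x.
  by apply/funext => x; rewrite mulrC.
have -> : K (e n) = fun x => (s ^+ n)^-1 * iter n.*2.+1 K (cst 1) x.
  by apply/funext => x; rewrite E KZ.
apply/funext => x; rewrite KZ// /e doubleS /= exprS.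
by field; rewrite (gt_eqF s0) (gt_eqF (sX0 n)).
Qed.

Let ip_eB m n : ip (fun x => e m x - e n x) (fun x => e m x - e n x)
  = b m.*2 - b (m + n) *+ 2 + b n.*2.
Proof.
have := sqrB_ip nu 1 (bme m) (bme n); rewrite !mul1r expr1n mul1r !ip_e !addnn.
by move=> <-; congr ip; apply/funext => x; rewrite mul1r.
Qed.

Let Ke_cauchy x : cvgn (fun n => K (e n) x).
Proof.
apply/cauchy_cvgP/cauchy_exP => r r0.
have bl n : limn b <= b n by exact: nonincreasing_cvgn_ge.
(* In [ip_eB] each outer term exceeds the limit by less than r^2 / 2, while the middle one removes
   at least twice the limit; the total stays below r^2. *)
have r20 : 0 < r ^+ 2 / 2 by rewrite divr_gt0 ?exprn_gt0.
have [N _ bN] : \forall n \near \oo, b n < limn b + r ^+ 2 / 2.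
  by apply: (cvgr_lt (limn b)) => //; rewrite ltrDl.
exists (K (e N) x); exists N => // n /= Nn.
rewrite -ball_normE /= -(ltr_pXn2r (n := 2)) ?nnegrE ?(ltW r0)//.
rewrite real_normK ?num_real// -KB//; apply: le_lt_trans (sqr_K_le nu W x _) _.
  exact: bmfunB.
rewrite ip_eB.
have bN2 : b N.*2 < limn b + r ^+ 2 / 2 by apply: bN; rewrite /= -addnn leq_addr.
have bn2 : b n.*2 < limn b + r ^+ 2 / 2.
  by apply: bN; rewrite /= -addnn (leq_trans Nn)// leq_addr.
by move: (bl (N + n)%N) bN2 bn2; lra.
Qed.

Let Ke_le1 n x : `|K (e n) x| <= 1.
Proof.
rewrite -(ler_pXn2r (n := 2))// ?nnegrE// real_normK ?num_real// expr1n.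
apply: le_trans (sqr_K_le nu W x (bme n)) _; rewrite ip_e.
apply: le_trans (b_nincr (leq0n _)) _.
by rewrite /b expr0 divr1 /= ip1.
Qed.

(** The limit g of T e_n satisfies T^2 g = s g, that is (T - l)(T + l) g = 0 with l = sqrt s, so T g
    + l g solves the eigenvalue equation for l. It is not zero because T g >= 0 and g has positive
    integral. *)
Lemma top_eigenvector : exists2 v, bmfun v &
  (exists x, v x != 0) /\ forall x, K v x = Num.sqrt s * v x.
Proof.
pose g x := limn (fun n => K (e n) x).
have Keg x : (fun n => K (e n) x) @ \oo --> g x by exact: Ke_cauchy.
have bmKe n : bmfun (K (e n)) by exact: bmfunK.
have bg : bmfun g.
  split.
    by apply: (measurable_fun_cvg (h := fun n => K (e n))) => // n; case: (bmKe n).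
  exists 1 => x; apply: (cvgr_to_le (cvg_norm (Keg x))).
  by apply: nearW => n; exact: Ke_le1.
have bKg := bmfunK nu W bg.
have KKg x : K (K g) x = s * g x.
  have H y : (fun n => K (K (e n)) y) @ \oo --> K g y.
    exact: (K_cvg bmKe bg Ke_le1).
  have H2 : (fun n => K (K (K (e n))) x) @ \oo --> K (K g) x.
    apply: (@K_cvg _ _ _ _ _ _ _ 1) => //; first by move=> n; exact: bmfunK.
    move=> n y; apply: le_trans (K_norm_le W y (bmfun_Lfun2 nu (bmKe n))) _.
    apply: le_trans (_ : \int[nu]_y (cst 1 y) <= _).
      apply: le_Rintegral => //; first exact/bmfun_integrable/bmfun_norm.
      exact/bmfun_integrable/bmfun_cst.
    by rewrite Rintegral_cst// (congr1 fine (probability_setT nu)) mulr1.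
  (* By [KK_e], T^3 e_n is s times the next term of the sequence T e_n, so it tends to s g as well
     as to T^2 g. *)
  have E : (fun n => K (K (K (e n))) x) = (fun n => s * K (e n.+1) x).
    by apply/funext => n; rewrite (KK_e n) KZ.
  have H3 : (fun n => K (K (K (e n))) x) @ \oo --> s * g x.
    rewrite E; apply: cvgM; first exact: cvg_cst.
    by rewrite (cvg_shiftS (fun n => K (e n) x)).
  exact: (cvg_unique _ H2 H3).
have g0 x : 0 <= g x.
  apply: limr_ge; first exact: Ke_cauchy.
  apply: nearW => n; apply: K_ge0 => y.
  by rewrite divr_ge0 ?(ltW (sX0 n))// iterK_ge0.
(* As W <= 1, the integral of T e_n is at least that of T^2 e_n = s e_(n+1), which is s b_(n+1) >=
   s^2; the bound passes to the limit. *)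
have Ig : 0 < \int[nu]_x g x.
  apply: (@lt_le_trans _ _ (s ^+ 2)); first exact: exprn_gt0.
  apply: (cvgr_to_ge (bounded_Rintegral_cvg (nu := nu) bmKe bg Ke_le1 Keg)).
  apply: nearW => n; apply: (@le_trans _ _ (s * b n.+1)).
    by rewrite expr2 ler_wpM2l// ltW.
  have -> : s * b n.+1 = \int[nu]_x (s * e n.+1 x).
    have <- : ip (e n.+1) (e 0) = b n.+1 by rewrite ip_e addn0.
    rewrite -ipZl//; apply: eq_Rintegral => x _.
    by rewrite /e /= expr0 divr1 mulr1.
  have -> : \int[nu]_x K (e n) x = \int[nu]_x (cst (\int[nu]_y `|K (e n) y|) x).
    rewrite Rintegral_cst// (congr1 fine (probability_setT nu)) mulr1.
    apply: eq_Rintegral => x _; rewrite ger0_norm// K_ge0// => y.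
    by rewrite divr_ge0 ?(ltW (sX0 n))// iterK_ge0.
  apply: le_Rintegral => //; [exact/bmfun_integrable/bmfunZ|exact/bmfun_integrable/bmfun_cst|].
  move=> x _; have := congr1 (@^~ x) (KK_e n); rewrite /= => <-.
  exact: le_trans (ler_norm _) (K_norm_le W x (bmfun_Lfun2 nu (bmKe n))).
have v0 : 0 < \int[nu]_x (K g x + Num.sqrt s * g x).
  rewrite RintegralD//; [|exact/bmfun_integrable|exact/bmfun_integrable/bmfunZ].
  apply: ltr_wpDl; first by apply: Rintegral_ge0 => x _; exact: K_ge0.
  by rewrite RintegralZl ?mulr_gt0 ?sqrtr_gt0//; exact: bmfun_integrable.
exists (fun x => K g x + Num.sqrt s * g x); first by apply: bmfunD => //; exact: bmfunZ.
split=> [|x].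
  apply: contrapT => /forallNP vx; move: v0.
  rewrite (_ : Rintegral _ _ _ = \int[nu]_x (cst 0 x)); last first.
    by apply: eq_Rintegral => x _; apply/eqP/negP => /negP; exact: vx.
  by rewrite Rintegral_cst// mul0r ltxx.
rewrite KD//; last exact: bmfunZ.
by rewrite KKg KZ// mulrDr addrC mulrA -expr2 sqr_sqrtr ?(ltW s0).
Qed.

End power_iteration.

(** * Null rectangles and bipartite pairs *)

Section no_edges.
Context d (T : measurableType d) (R : realType) (nu : probability T R).
Implicit Types (W : graphon T R) (A B C D : set T).

(** Iterated null sets match the way T reads W, one section at a time, and make countable unions
    immediate; [no_edgesP] translates to the product measure. *)
Definition no_edges W A B : Prop :=
  {ae nu, forall x, A x -> {ae nu, forall y, B y -> W (x, y) = 0}}.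

Lemma no_edgesS W A B C D : C `<=` A -> D `<=` B -> no_edges W A B -> no_edges W C D.
Proof.
rewrite /no_edges => CA DB WAB; apply: filterS WAB => x WxB /CA /WxB {}WxB.
by apply: filterS WxB => y WxyB /DB.
Qed.

Lemma no_edgesU2 W A B C : no_edges W A B -> no_edges W A C -> no_edges W A (B `|` C).
Proof.
rewrite /no_edges => WAB WAC; apply: filterS2 WAB WAC => x H1 H2 Ax.
apply: filterS2 (H1 Ax) (H2 Ax) => y h1 h2.
by case; [exact: h1|exact: h2].
Qed.

Lemma no_edgesU1 W A B C : no_edges W A C -> no_edges W B C -> no_edges W (A `|` B) C.
Proof.
rewrite /no_edges => WAC WBC; apply: filterS2 WAC WBC => x H1 H2.
by case; [exact: H1|exact: H2].
Qed.

Lemma no_edges_bigcupl W (A : nat -> set T) B :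
  (forall n, no_edges W (A n) B) -> no_edges W (\bigcup_n A n) B.
Proof. rewrite /no_edges; by move=> /ae_foralln; apply: filterS => x H [n _]; exact: H. Qed.

Lemma no_edges_bigcupr W A (B : nat -> set T) :
  (forall n, no_edges W A (B n)) -> no_edges W A (\bigcup_n B n).
Proof.
rewrite /no_edges => /ae_foralln; apply: filterS => x H Ax.
have /ae_foralln : forall n, {ae nu, forall y, B n y -> W (x, y) = 0}.
  by move=> n; exact: H.
by apply: filterS => y h [n _]; exact: h.
Qed.

Let f W A B (z : T * T) : R := \1_A z.1 * W z * \1_B z.2.

Let f0 W A B z : 0 <= f W A B z.
Proof. by rewrite !mulr_ge0 ?graphon_ge0. Qed.

Let fP W A B z : f W A B z = 0 <-> ((A `*` B) z -> W z = 0).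
Proof.
rewrite /f !indicE; split.
  by move=> + [/= Az Bz]; rewrite !mem_set// mul1r mulr1.
case: (boolP (z.1 \in A)) => [/set_mem Az|_ _]; last by rewrite !mul0r.
case: (boolP (z.2 \in B)) => [/set_mem Bz|_ _]; last by rewrite mulr0.
by move=> ->//; rewrite mulr0 mul0r.
Qed.

Let mf W A B : measurable A -> measurable B ->
  measurable_fun setT (EFin \o f W A B).
Proof.
move=> mA mB; apply/measurable_EFinP.
apply: measurable_funM; first apply: measurable_funM.
- exact: measurableT_comp.
- exact: graphon_measurable.
- exact: measurableT_comp.
Qed.

(** The integrand is nonnegative, so the iterated integral vanishes exactly when the integrand
    vanishes a.e. in almost every section. Tonelli's theorem then gives both [no_edgesP] and
    [no_edges_sym]. *)
Let no_edges_integral W A B : measurable A -> measurable B ->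
  no_edges W A B <-> (\int[nu]_x \int[nu]_y (f W A B (x, y))%:E = 0)%E.
Proof.
move=> mA mB; have mE := mf W mA mB.
have mfx x : measurable_fun setT (fun y => (f W A B (x, y))%:E).
  exact: (measurableT_comp mE).
have m1 : measurable_fun setT (fun x => (\int[nu]_y (f W A B (x, y))%:E)%E).
  by apply: (measurable_fun_fubini_tonelli_F (EFin \o f W A B)) => // z; rewrite /= lee_fin.
have P2 := ae_eq_integral_abs nu measurableT m1.
have P3 x := ae_eq_integral_abs nu measurableT (mfx x).
have E1 x : (\int[nu]_y (f W A B (x, y))%:E = \int[nu]_y `|(f W A B (x, y))%:E|)%E.
  by apply: eq_integral => y _; rewrite gee0_abs ?lee_fin.
have E2 : (\int[nu]_x \int[nu]_y (f W A B (x, y))%:E =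
    \int[nu]_x `|\int[nu]_y (f W A B (x, y))%:E|)%E.
  by apply: eq_integral => x _; rewrite gee0_abs ?integral_ge0// => y _; rewrite lee_fin.
rewrite /no_edges E2; split.
- move=> H; apply/P2; apply: filterS H => x H _; rewrite E1; apply/P3.
  have [Ax|Ax] := pselect (A x); last first.
    by apply: aeW => y _ /=; congr EFin; apply/fP => -[/=].
  by apply: filterS (H Ax) => y h _ /=; congr EFin; apply/fP => -[_ /=]; exact: h.
- move=> /P2; apply: filterS => x /(_ I); rewrite E1 => /P3 H1 Ax.
  apply: filterS H1 => y /(_ I) /= [] /(fP W A B (x, y)) H2 By.
  exact: H2.
Qed.

Lemma no_edgesP W A B : measurable A -> measurable B ->
  {ae (nu \x nu)%E, forall z, (A `*` B) z -> W z = 0} <-> no_edges W A B.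
Proof.
move=> mA mB; rewrite no_edges_integral//.
have mE := mf W mA mB.
have -> : (\int[nu]_x \int[nu]_y (f W A B (x, y))%:E
    = \int[nu \x nu]_z `|(EFin \o f W A B) z|)%E.
  under [RHS]eq_integral do rewrite gee0_abs ?lee_fin//.
  by rewrite fubini_tonelli1//= => z; rewrite lee_fin.
have P1 := ae_eq_integral_abs (nu \x nu)%E measurableT mE.
split=> [H|/P1].
  by apply/P1; apply: filterS H => z /fP /= -> _.
by apply: filterS => z /(_ I) [] /fP.
Qed.

Lemma no_edges_sym W A B : measurable A -> measurable B ->
  no_edges W A B -> no_edges W B A.
Proof.
move=> mA mB; rewrite !no_edges_integral// => <-.
rewrite [RHS](fubini_tonelli (EFin \o f W A B))//; last 2 first.
  - exact: mf.
  - by move=> z; rewrite /= lee_fin.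
apply: eq_integral => x _; apply: eq_integral => y _; congr EFin.
by rewrite /f /= graphon_sym mulrC mulrA mulrAC.
Qed.

(** A nonnegative integrand W(x, .) p with zero integral vanishes a.e., so W(x, .) does where p > 0.
    This is how equations for T become missing edges. *)
Lemma K_eq0_no_edges W C (p : T -> R) : bmfun p -> (forall x, 0 <= p x) ->
  {ae nu, forall x, C x -> kernel_integral nu W p x = 0} ->
  no_edges W C [set y | 0 < p y].
Proof.
move=> bp p0 Kp0; rewrite /no_edges; apply: filterS Kp0 => x H /H {}H.
have := ae0_ge0_Rintegral (nu := nu) (bmfunM (bmfun_graphon W x) bp) _ H.
move=> /(_ (fun y => mulr_ge0 (graphon_ge0 W _) (p0 y))).
apply: filterS => y /eqP; rewrite mulf_eq0 => /orP[/eqP//|/eqP py0].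
by rewrite /= py0 ltxx.
Qed.

Lemma K_sqnorm_eq0 W : K_sqnorm nu W = 0 -> no_edges W setT setT.
Proof.
move=> s0; have b1 : bmfun (@cst T R 1) by exact: bmfun_cst.
have bK1 := bmfunK nu W b1.
have -> : setT = [set y : T | 0 < @cst T R 1 y] by apply/seteqP; split => y //= _; exact: ltr01.
apply: K_eq0_no_edges => //.
have := ae0_ge0_Rintegral (nu := nu) (bmfunM bK1 bK1).
have -> : \int[nu]_x (kernel_integral nu W (cst 1) x * kernel_integral nu W (cst 1) x) = 0.
  apply: le_anti; rewrite [X in _ && X](ip_ge0 nu) andbT.
  rewrite -[leRHS](mul0r (ip nu (cst 1) (cst 1))) -s0.
  exact: ip_K_sqnorm.
move=> /(_ _ erefl) H; apply: filterS (H _) => [x /eqP|x]; last by rewrite -expr2 sqr_ge0.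
by rewrite mulf_eq0 orbb => /eqP.
Qed.

Definition bipartite_pair W A B := [/\ measurable A, measurable B, A `&` B = set0,
  no_edges W A (~` B) & no_edges W B (~` A)].

(** With h = |u|, l h <= T h holds pointwise while l bounds the norm of T, so T h = l h a.e. Then
    T(h + u) = 0 a.e. on {u > 0}, T(h - u) = 0 a.e. on {u < 0} and T h = 0 a.e. on {u = 0}, and
    [K_eq0_no_edges] removes the corresponding edges. *)
Lemma negative_eigenfunction_bipartite_pair W (l : R) (u : T -> R) : 0 < l -> bmfun u ->
  (forall f, bmfun f ->
    ip nu (kernel_integral nu W f) (kernel_integral nu W f) <= l ^+ 2 * ip nu f f) ->
  (forall x, kernel_integral nu W u x = - l * u x) ->
  bipartite_pair W [set x | 0 < u x] [set x | u x < 0].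
Proof.
move=> l0 bu Kl Ku; set K := kernel_integral nu W in Kl Ku *.
pose h x := `|u x|.
have bh : bmfun h by exact: bmfun_norm.
have bK : bmfun (K h) by exact: bmfunK.
have Kh x : l * h x <= K h x.
  by rewrite -[l]gtr0_norm// -normrM -normrN -mulNr -Ku norm_K_le.
have Khl : {ae nu, forall x, K h x = l * h x}.
  have blh := bmfunB bK (bmfunZ l bh).
  (* Expand to |T h|^2 - 2 l <T h, h> + l^2 |h|^2, where |T h|^2 <= l^2 |h|^2 and <T h, h> >= l
     |h|^2. *)
  have H : ip nu (fun x => K h x - l * h x) (fun x => K h x - l * h x) = 0.
    apply: le_anti; rewrite ip_ge0 andbT sqrB_ip//.
    have H1 := Kl _ bh.
    have : ip nu (fun x => l * h x) h <= ip nu (K h) h.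
      apply: le_ip => //; first exact: bmfunZ.
      by move=> x; rewrite ler_wpM2r// /h.
    rewrite ipZl// => H2; have := ler_wpM2l (ltW l0) H2; rewrite mulrA -expr2.
    by move: H1; rewrite -/K; lra.
  have := ae0_ge0_Rintegral (nu := nu) (bmfunM blh blh) _ H.
  move=> /(_ (fun x => _)) H2; apply: filterS (H2 _) => [x|x]; last by rewrite -expr2 sqr_ge0.
  by move/eqP; rewrite mulf_eq0 orbb subr_eq0 => /eqP.
have mu' : measurable_fun setT u by case: bu.
have mP : measurable [set x | 0 < u x].
  rewrite -[X in measurable X]setTI (_ : [set x | 0 < u x] = u @^-1` `]0, +oo[%classic).
    exact: mu'.
  by apply/seteqP; split => x /=; rewrite in_itv/= andbT.
have mN : measurable [set x | u x < 0].
  rewrite -[X in measurable X]setTI (_ : [set x | u x < 0] = u @^-1` `]-oo, 0[%classic).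
    exact: mu'.
  by apply/seteqP; split => x /=; rewrite in_itv/=.
have m0 : measurable [set x | u x = 0].
  by rewrite -[X in measurable X]setTI; exact: (mu' measurableT [set 0] (measurable_set1 0)).
have PP : no_edges W [set x | 0 < u x] [set x | 0 < u x].
  apply: (@no_edgesS _ [set x | 0 < u x] [set x | 0 < h x + u x]) => //.
    by move=> x /= ux; rewrite /h addr_gt0 ?normr_gt0 ?gt_eqF.
  apply: K_eq0_no_edges; first exact: bmfunD.
    by move=> x; rewrite /h -lerBlDr sub0r -normrN ler_norm.
  apply: filterS Khl => x Khx /= ux.
  by rewrite KD// -/K Khx Ku /h gtr0_norm// mulNr subrr.
have NN : no_edges W [set x | u x < 0] [set x | u x < 0].
  apply: (@no_edgesS _ [set x | u x < 0] [set x | 0 < h x - u x]) => //.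
    by move=> x /= ux; rewrite /h addr_gt0 ?normr_gt0 ?lt_eqF// oppr_gt0.
  apply: K_eq0_no_edges; first exact: bmfunB.
    by move=> x; rewrite subr_ge0 ler_norm.
  apply: filterS Khl => x Khx /= ux.
  by rewrite KB// -/K Khx Ku /h ltr0_norm// mulNr mulrN subrr.
have Z : no_edges W [set x | u x = 0] [set x | 0 < h x].
  apply: K_eq0_no_edges => [//|x|]; first exact: normr_ge0.
  apply: filterS Khl => x Khx /= ux.
  by rewrite -/K Khx /h ux normr0 mulr0.
have mh : measurable [set x | 0 < h x].
  rewrite (_ : [set x | 0 < h x] = ~` [set x | u x = 0]); first exact: measurableC.
  by apply/seteqP; split => x /=; rewrite normr_gt0 => /eqP.
have Z' := no_edges_sym m0 mh Z.
split => //.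
- by apply/seteqP; split => x //= [ux /(lt_trans ux)]; rewrite ltxx.
- apply: (@no_edgesS _ [set x | 0 < u x] ([set x | 0 < u x] `|` [set x | u x = 0])) => //.
    by move=> x /= /negP; rewrite -leNgt le_eqVlt => /predU1P[->|]; [right|left].
  apply: no_edgesU2 => //; apply: no_edgesS Z' => // x /= ux.
  by rewrite normr_gt0 gt_eqF.
- apply: (@no_edgesS _ [set x | u x < 0] ([set x | u x < 0] `|` [set x | u x = 0])) => //.
    by move=> x /= /negP; rewrite -leNgt le_eqVlt => /predU1P[->|]; [right|left].
  apply: no_edgesU2 => //; apply: no_edgesS Z' => // x /= ux.
  by rewrite normr_gt0 lt_eqF.
Qed.

End no_edges.

(** * Exhaustion by bipartite pairs *)

Section exhaustion.
Context d (T : measurableType d) (R : realType) (nu : probability T R).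
Variable W : graphon T R.
Implicit Types A B C D S : set T.
Local Notation NE := (no_edges nu W).
Local Notation bp := (bipartite_pair nu W).

Lemma bipartite_pairC A B : bp A B -> bp B A.
Proof. by case=> mA mB AB0 AB BA; split=> //; rewrite setIC. Qed.

Lemma bipartite_pair_setC_no_edges A B : bp A B -> NE (~` (A `|` B)) (A `|` B).
Proof.
move=> [mA mB AB0 AB BA]; apply: no_edges_sym.
- exact: measurableU.
- exact/measurableC/measurableU.
- rewrite /no_edges in AB BA *; apply: filterS2 AB BA => x H1 H2 [/H1|/H2] {}H1;
    apply: filterS H1 => y Wy yAB; apply: Wy => yn; apply: yAB; [by right|by left].
Qed.

(** The pairs may disagree on overlaps, so a point takes its side from the first pair that covers
    it, which [seqDU] selects. This is consistent: no edge leaves an earlier A_k u B_k, so a point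
    first covered at stage n has, up to null sets, no neighbour there. *)
Lemma bipartite_pair_bigcup (A B : nat -> set T) : (forall n, bp (A n) (B n)) ->
  exists A' B', bp A' B' /\ forall n, A n `|` B n `<=` A' `|` B'.
Proof.
move=> AB; pose S n := A n `|` B n.
have mA n : measurable (A n) by case: (AB n).
have mB n : measurable (B n) by case: (AB n).
have mS n : measurable (S n) by exact: measurableU.
have mD n : measurable (seqDU S n) by exact: seqDU_measurable.
have SD k n x : (k < n)%N -> S k x -> ~ seqDU S n x.
  by move=> kn Skx [_]; apply; rewrite -bigcup_mkord; exists k.
have half (A1 B1 : nat -> set T) : (forall n, bp (A1 n) (B1 n)) ->
    (forall n, A1 n `|` B1 n = S n) ->
    NE (\bigcup_n (A1 n `&` seqDU S n)) (~` \bigcup_n (B1 n `&` seqDU S n)).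
  move=> bip1 S1; apply: no_edges_bigcupl => n.
  (* A point outside the union of the new B sides lies outside B_n, or lies in B_n but was covered
     at an earlier stage. *)
  apply: (@no_edgesS _ _ _ _ _ (A1 n `&` seqDU S n)
    (~` B1 n `|` \bigcup_k (if (k < n)%N then S k else set0))) => //.
    move=> y /= yB; have [B1y|?] := pselect (B1 n y); last by left.
    right; apply: contrapT => yS; apply: yB; exists n => //; split => //; split.
      by rewrite -S1; right.
    rewrite -bigcup_mkord => -[k /= kn Sky]; apply: yS; exists k => //.
    by rewrite kn.
  apply: no_edgesU2.
    by case: (bip1 n) => _ _ _ + _; apply: no_edgesS => // x [].
  apply: no_edges_bigcupr => k; case: ifPn => kn; last first.
    by rewrite /no_edges; apply: aeW => x _; apply: aeW.
  have := bipartite_pair_setC_no_edges (bip1 k); rewrite S1; apply: no_edgesS => // x [_ Dx].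
  by move=> Skx; exact: (SD k n x kn Skx Dx).
exists (\bigcup_n (A n `&` seqDU S n)), (\bigcup_n (B n `&` seqDU S n)); split.
  split.
  - by apply: bigcupT_measurable => n; exact: measurableI.
  - by apply: bigcupT_measurable => n; exact: measurableI.
  - apply/seteqP; split => x //= [[n _ [Anx Dnx]] [m _ [Bmx Dmx]]].
    have [nm|mn|nm] := ltngtP n m.
    + by apply: (SD n m x nm _ Dmx); left.
    + by apply: (SD m n x mn _ Dnx); right.
    + case: (AB n) => _ _ + _ _.
      by rewrite -[X in _ -> X]/(set0 x) => <-; split=> //; rewrite nm.
  - exact: half.
  - by apply: half => n; [exact: bipartite_pairC|rewrite setUC].
move=> n x Sx; have : (\bigcup_n S n) x by exists n.
rewrite seqDU_bigcup_eq => -[m _ Dx]; have [[Am|Bm] _] := Dx.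
  by left; exists m.
by right; exists m.
Qed.

(** Pairs whose measures come within 1/(n+1) of the supremum are merged by [bipartite_pair_bigcup];
    the merged pair covers each of them, so it attains the supremum. *)
Lemma bipartite_pair_maximal : exists A B, bp A B /\
  forall A' B', bp A' B' -> (nu (A' `|` B') <= nu (A `|` B))%E.
Proof.
pose E := [set fine (nu (AB.1 `|` AB.2)) | AB in [set AB : set T * set T | bp AB.1 AB.2]].
have bip0 : bp set0 set0.
  split=> //; first by rewrite setI0.
    by rewrite /no_edges; apply: aeW.
  by rewrite /no_edges; apply: aeW.
have fle A B C D : measurable A -> measurable B -> measurable C -> measurable D ->
    (fine (nu (A `|` B)) <= fine (nu (C `|` D))) = (nu (A `|` B) <= nu (C `|` D))%E.
  by move=> mA mB mC mD; rewrite -lee_fin !fineK// fin_num_measure//; exact: measurableU.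
have supE : has_sup E.
  split; first by exists (fine (nu (set0 `|` set0))), (set0, set0).
  exists 1 => _ [[A B] /= [mA mB _ _ _] <-].
  rewrite -lee_fin fineK ?fin_num_measure//; last exact: measurableU.
  by apply: probability_le1; exact: measurableU.
have /choice[AB HAB] n : exists AB : set T * set T,
    bp AB.1 AB.2 /\ sup E - n.+1%:R^-1 < fine (nu (AB.1 `|` AB.2)).
  have n0 : 0 < n.+1%:R^-1 :> R by rewrite invr_gt0.
  have [_ [AB bAB <-] H] := sup_adherent n0 supE.
  by exists AB.
have [A [B [bAB HS]]] := bipartite_pair_bigcup (fun n => (HAB n).1).
exists A, B; split => // A' B' b'.
have [mA mB _ _ _] := bAB; have [mA' mB' _ _ _] := b'.
rewrite -fle//; apply: (@le_trans _ _ (sup E)).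
  by apply: ub_le_sup; [case: supE|exists (A', B')].
rewrite leNgt; apply/negP => /ltr_add_invr[k Hk].
have [[mAk mBk _ _ _] HABk] := HAB k.
have : fine (nu ((AB k).1 `|` (AB k).2)) <= fine (nu (A `|` B)).
  by rewrite fle// le_measure ?inE//; exact: measurableU.
by move: Hk HABk; move: (_ ^-1) => r; lra.
Qed.

End exhaustion.

(** * Restriction of a graphon to a measurable set *)

Section restriction.
Context d (T : measurableType d) (R : realType) (nu : probability T R).
Variables (W : graphon T R) (S : set T) (mS : measurable S).

Definition restrict_fun (z : T * T) : R := \1_S z.1 * W z * \1_S z.2.

Let restrict_measurable : measurable_fun setT restrict_fun.
Proof.
apply: measurable_funM; first apply: measurable_funM.
- exact: measurableT_comp.
- exact: graphon_measurable.
- exact: measurableT_comp.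
Qed.

Let restrict_sym x y : restrict_fun (x, y) = restrict_fun (y, x).
Proof. by rewrite /restrict_fun graphon_sym /= mulrC mulrA mulrAC. Qed.

Let restrict_itv z : 0 <= restrict_fun z <= 1.
Proof.
rewrite /restrict_fun !indicE; have := graphon_itv W z.
by do 2 case: (_ \in _); rewrite ?mul1r ?mulr1 ?mul0r ?mulr0 ?lexx ?ler01.
Qed.

Definition restrict_graphon : graphon T R :=
  Graphon restrict_measurable restrict_sym restrict_itv.

Lemma K_restrict f x : bmfun f -> kernel_integral nu restrict_graphon f x
  = \1_S x * kernel_integral nu W (fun y => \1_S y * f y) x.
Proof.
move=> bf; rewrite /kernel_integral -RintegralZl//.
  by apply: eq_Rintegral => y _; rewrite /= /restrict_fun /=; ring.
by apply/kernel_integrable/bmfun_Lfun2/bmfunM => //; exact: bmfun_indic.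
Qed.

End restriction.

(** * Enlarging a bipartite pair by one inside its complement *)

Section extension.
Context d (T : measurableType d) (R : realType) (nu : probability T R).
Variables (W : graphon T R) (A B : set T).
Hypothesis bAB : bipartite_pair nu W A B.
Local Notation S := (~` (A `|` B)).
Hypothesis mS : measurable S.

(** One of the two edge conditions, stated for any pair (C, D) with complement S so that exchanging
    the sides gives the other. *)
Let half C D C' D' : bipartite_pair nu W C D -> S = ~` (C `|` D) -> C' `<=` S -> D' `<=` S ->
  no_edges nu (restrict_graphon W mS) C' (~` D') ->
  no_edges nu W (C `|` C') (~` (D `|` D')).
Proof.
move=> bCD SE C'S D'S ne; have [mC mD CD0 neCD neDC] := bCD.
have C'D : C' `<=` ~` D.
  by move=> x /C'S; rewrite SE => H Dx; apply: H; right.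
have ne1 : no_edges nu W C' C.
  have := no_edges_sym mC (measurableC mD) neCD; exact: no_edgesS.
apply: no_edgesU1.
  by apply: no_edgesS neCD => // x H Dx; apply: H; left.
(* A point outside D u D' is in C, which has no edges to C' because C' avoids D, or in S but not in
   D', where the restricted graphon agrees with W. *)
apply: (@no_edgesS _ _ _ _ _ C' (C `|` (S `&` ~` D'))) => //.
  move=> x H; have [Cx|Cx] := pselect (C x); [by left|right; split].
    by rewrite SE => -[//|Dx]; apply: H; left.
  by move=> D'x; apply: H; right.
apply: no_edgesU2 => //; rewrite /no_edges in ne *.
apply: filterS ne => x H C'x; apply: filterS (H C'x) => y {}H [Sy D'y].
by have := H D'y; rewrite /= /restrict_fun /= !indicE !mem_set ?mul1r ?mulr1//; exact: C'S.
Qed.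

Lemma bipartite_pair_extend A' B' : A' `<=` S -> B' `<=` S ->
  bipartite_pair nu (restrict_graphon W mS) A' B' -> bipartite_pair nu W (A `|` A') (B `|` B').
Proof.
move=> A'S B'S [mA' mB' A'B'0 ne1 ne2]; have [mA mB AB0 _ _] := bAB.
split; [exact: measurableU|exact: measurableU| | |].
- apply/seteqP; split => x //= [[Ax|/[dup] A'x /A'S Sx] [Bx|/[dup] B'x /B'S Sx']].
  + by have : (A `&` B) x by []; rewrite AB0.
  + by apply: Sx'; left.
  + by apply: Sx; right.
  + by have : (A' `&` B') x by []; rewrite A'B'0.
- exact: half.
- by apply: half => //; [exact: bipartite_pairC|rewrite setUC].
Qed.

End extension.

(** * Finiteness of multiplicities *)

Section finite_multiplicity.
Context d (T : measurableType d) (R : realType) (nu : probability T R).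
Variables (W : graphon T R) (l : R).
Hypothesis l0 : l != 0.
Local Notation K := (kernel_integral nu W).
Local Notation ip := (ip nu).

(** For l nonzero, the equation at every point singles out the representative T f / l of the class
    of f. As T ignores null sets, such a function is zero everywhere once it is zero a.e. *)
Definition eigenfunction (f : T -> R) := bmfun f /\ forall x, K f x = l * f x.

Definition orthonormal_eigenfunctions k (e : 'I_k -> T -> R) :=
  (forall i, eigenfunction (e i)) /\ forall i j, ip (e i) (e j) = (i == j)%:R.

Lemma eigenfunction_ae0 f : eigenfunction f -> {ae nu, forall x, f x = 0} ->
  forall x, f x = 0.
Proof.
move=> [bf Kf] f0 x; apply/eqP; rewrite -(inj_eq (mulfI l0)) mulr0 -Kf; apply/eqP.
rewrite (@kernel_integral_ae _ _ _ _ _ _ (cst 0)) ?bmfun_Lfun2//; last 2 first.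
- exact: bmfun_cst.
- by apply: filterS f0.
rewrite /kernel_integral; under eq_Rintegral do rewrite mulr0.
by rewrite Rintegral_cst// mul0r.
Qed.

Lemma eigenfunction_ip_gt0 f x : eigenfunction f -> f x != 0 -> 0 < ip f f.
Proof.
move=> ef fx; rewrite lt_neqAle ip_ge0 andbT eq_sym; apply/eqP => f0.
have [bf _] := ef; move/eqP : fx; apply; apply: eigenfunction_ae0 => //.
have := ae0_ge0_Rintegral (nu := nu) (bmfunM bf bf) _ f0.
move=> H; apply: filterS (H _) => [y /eqP|y]; last by rewrite -expr2 sqr_ge0.
by rewrite mulf_eq0 orbb => /eqP.
Qed.

Lemma eigenfunctionZ a f : eigenfunction f -> eigenfunction (fun x => a * f x).
Proof. by move=> [bf Kf]; split=> [|x]; [exact: bmfunZ|rewrite KZ// Kf mulrCA]. Qed.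

Lemma eigenfunctionB f g : eigenfunction f -> eigenfunction g ->
  eigenfunction (fun x => f x - g x).
Proof.
by move=> [bf Kf] [bg Kg]; split=> [|x]; [exact: bmfunB|rewrite KB// Kf Kg mulrBr].
Qed.

Lemma eigenfunction_sum n (f : 'I_n -> T -> R) : (forall i, eigenfunction (f i)) ->
  eigenfunction (fun x => \sum_i f i x).
Proof.
move=> ef; have bf i : bmfun (f i) by case: (ef i).
split=> [|x]; first exact: bmfun_sum.
by rewrite K_sum// mulr_sumr; apply: eq_bigr => i _; case: (ef i).
Qed.

Lemma ip_sum_orthonormal k (e : 'I_k -> T -> R) (a : 'I_k -> R) j :
  orthonormal_eigenfunctions e ->
  ip (fun x => \sum_i a i * e i x) (e j) = a j.
Proof.
move=> [ee eij]; have be i : bmfun (e i) by case: (ee i).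
rewrite (ip_suml nu (f := fun i x => a i * e i x))//; last by move=> i; exact: bmfunZ.
under eq_bigr do rewrite ipZl// eij.
rewrite (bigD1 j)//= eqxx mulr1 big1 ?addr0// => i /negPf ->.
by rewrite mulr0.
Qed.

(** The sum of the l^2 e_i(x)^2 is at most 1 for every x; on integration each index contributes
    l^2. *)
Lemma orthonormal_eigenfunctions_card k (e : 'I_k -> T -> R) :
  orthonormal_eigenfunctions e -> l ^+ 2 * k%:R <= 1.
Proof.
move=> oe; have [ee eij] := oe; have be i : bmfun (e i) by case: (ee i).
pose q x := \sum_i e i x * e i x.
have bq : bmfun q by apply: bmfun_sum => i; exact: bmfunM.
have q1 x : l ^+ 2 * q x <= 1.
  have q0 : 0 <= q x by apply: sumr_ge0 => i _; rewrite -expr2 sqr_ge0.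
  (* Bessel's inequality at x, obtained by evaluating T phi at x. *)
  pose phi y := \sum_i e i x * e i y.
  have bphi : bmfun phi by apply: bmfun_sum => i; exact: bmfunZ.
  have Kphi : K phi x = l * q x.
    rewrite (K_sum nu W (f := fun i y => e i x * e i y)); last by move=> i; exact: bmfunZ.
    rewrite mulr_sumr; apply: eq_bigr => i _; rewrite KZ//.
    by case: (ee i) => _ ->; rewrite mulrCA.
  have phi2 : ip phi phi = q x.
    rewrite {1}/phi (ip_suml nu (f := fun i y => e i x * e i y))//; last first.
      by move=> i; exact: bmfunZ.
    apply: eq_bigr => i _; rewrite ipZl// ipC.
    by rewrite (ip_sum_orthonormal (fun i => e i x) i oe).
  have := sqr_K_le nu W x bphi; rewrite Kphi phi2.
  move: q0; rewrite le_eqVlt => /predU1P[<-|q0 qH]; first by rewrite !mulr0.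
  rewrite -(ler_pM2r q0) mul1r; apply: le_trans qH.
  by rewrite exprMn (expr2 (q x)) mulrA.
have <- : \int[nu]_x q x = k%:R.
  transitivity (ip (fun x => \sum_i (fun i x => e i x * e i x) i x) (cst 1)).
    by apply: eq_Rintegral => x _; rewrite mulr1.
  rewrite ip_suml; [|by move=> i; exact: bmfunM|exact: bmfun_cst].
  transitivity (\sum_(i < k) (1 : R)); last by rewrite sumr_const card_ord.
  apply: eq_bigr => i _; transitivity (ip (e i) (e i)); last by rewrite eij eqxx.
  by apply: eq_Rintegral => x _; rewrite mulr1.
rewrite -RintegralZl//; last exact: bmfun_integrable.
apply: le_trans (_ : \int[nu]_x (cst 1 x) <= _).
  apply: le_Rintegral => //; [exact/bmfun_integrable/bmfunZ|exact/bmfun_integrable/bmfun_cst].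
by rewrite Rintegral_cst// (congr1 fine (probability_setT nu)) mulr1.
Qed.

(** A Gram-Schmidt step: the residual of f is an eigenfunction that does not vanish at x, so its
    norm is positive and it can be normalised. *)
Lemma orthonormal_extend k (e : 'I_k -> T -> R) f x :
  orthonormal_eigenfunctions e -> eigenfunction f ->
  f x != \sum_i ip f (e i) * e i x ->
  exists e' : 'I_k.+1 -> T -> R, orthonormal_eigenfunctions e'.
Proof.
move=> oe ef fx; have [ee eij] := oe.
have be i : bmfun (e i) by case: (ee i).
have bf : bmfun f by case: ef.
pose p y := \sum_i ip f (e i) * e i y.
have ep : eigenfunction p by apply: eigenfunction_sum => i; exact: eigenfunctionZ.
pose g y := f y - p y.
have eg : eigenfunction g by exact: eigenfunctionB.
have gg0 : 0 < ip g g by apply: (@eigenfunction_ip_gt0 _ x) => //; rewrite subr_eq0.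
have bg : bmfun g by case: eg.
have gej j : ip g (e j) = 0.
  rewrite ipBl//; last by case: ep.
  by rewrite (ip_sum_orthonormal (fun i => ip f (e i)) j oe) subrr.
pose r := (Num.sqrt (ip g g))^-1.
pose h y := r * g y.
have bh : bmfun h by exact: bmfunZ.
have hh : ip h h = 1.
  rewrite ipZl// ipC ipZl// mulrA -expr2 exprVn sqr_sqrtr ?(ltW gg0)//.
  by rewrite mulVf ?gt_eqF.
have hej j : ip h (e j) = 0 by rewrite ipZl// gej mulr0.
exists (fun i => oapp e h (unlift ord_max i)); split=> [i|i j].
  by case: unliftP => [j _|_] //=; exact: eigenfunctionZ.
case: unliftP => [i' ->|->]; case: unliftP => [j' ->|->] /=.
- by rewrite eij (inj_eq lift_inj).
- by rewrite ipC hej eq_sym (negPf (neq_lift _ _)).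
- by rewrite hej (negPf (neq_lift _ _)).
- by rewrite hh eqxx.
Qed.

(** If no orthonormal family spanned, [orthonormal_extend] would produce families of every size,
    against the bound l^(-2) on their size. *)
Lemma orthonormal_span : exists k (e : 'I_k -> T -> R),
  orthonormal_eigenfunctions e /\
  forall f, eigenfunction f -> forall x, f x = \sum_i ip f (e i) * e i x.
Proof.
apply: contrapT => H.
have Hk k : exists e : 'I_k -> T -> R, orthonormal_eigenfunctions e.
  elim: k => [|k [e oe]]; first by exists (fun _ => cst 0); split; case.
  apply: contrapT => H1; apply: H; exists k, e; split => // f ef x.
  apply/eqP; apply: contrapT => /negP fx; apply: H1.
  exact: orthonormal_extend oe ef fx.
have l2 : 0 < l ^+ 2 by rewrite exprn_even_gt0.
have [e oe] := Hk (Num.Def.archi_bound (l ^- 2)).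
have := orthonormal_eigenfunctions_card oe.
have lV : 0 <= l ^- 2 by rewrite invr_ge0 ltW.
have := archi_boundP lV.
by rewrite -(ltr_pM2l l2) divff ?gt_eqF// => /lt_le_trans/[apply]; rewrite ltxx.
Qed.

(** Take k to be the size of a spanning orthonormal family. The coordinates of the f_i form an n by
    k matrix, and for k < n a nonzero row of its left kernel is a linear relation. *)
Lemma eigenfunctions_dependent : exists k, forall n (f : 'I_n -> T -> R),
  (k < n)%N -> (forall i, eigenfunction (f i)) ->
  exists c : 'I_n -> R, (exists i, c i != 0) /\ forall x, \sum_i c i * f i x = 0.
Proof.
have [k [e [oe se]]] := orthonormal_span; exists k => n f kn ef.
pose M := \matrix_(i < n, j < k) ip (f i) (e j).
have : kermx M != 0.
  by rewrite kermx_eq0 /row_free neq_ltn (leq_ltn_trans (rank_leq_col M)).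
move=> /matrix0Pn[i [j cij]]; exists (fun j => kermx M i j); split; first by exists j.
have kM j' : \sum_h kermx M i h * ip (f h) (e j') = 0.
  transitivity ((kermx M *m M) i j'); last by rewrite mulmx_ker mxE.
  by rewrite mxE; apply: eq_bigr => h _; rewrite [M h j']mxE.
move=> x; under eq_bigr => h _ do rewrite (se (f h))// mulr_sumr.
rewrite exchange_big big1// => h _.
by under eq_bigr do rewrite mulrA; rewrite -mulr_suml kM mul0r.
Qed.

End finite_multiplicity.

(** * Eigenspaces in L2 *)

Section Lspace_eigen.
Context d (T : measurableType d) (R : realType) (nu : probability T R).
Variable W : graphon T R.
Local Notation K := (kernel_integral nu W).
Local Notation L2 := (LspaceType2 nu).

(** Flipping signs and cutting down to a set yield the equation only almost everywhere;
    [eigenvector_rep] leads back to the pointwise notion. *)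
Definition ae_eigenfunction (l : R) (f : T -> R) :=
  bmfun f /\ {ae nu, forall x, K f x = l * f x}.

Definition ae_independent n (f : 'I_n -> T -> R) := forall c : 'I_n -> R,
  {ae nu, forall x, \sum_i c i * f i x = 0} -> forall i, c i = 0.

Definition eigenfamily l n := exists f : 'I_n -> T -> R,
  (forall i, ae_eigenfunction l (f i)) /\ ae_independent f.

Definition Lspace_of_bm f (bf : bmfun f) : L2 :=
  Lspace_of (Lfun_Sub (lee1n 2) (bmfun_Lfun2 nu bf)).

Lemma Lspace_of_bmE f (bf : bmfun f) :
  {ae nu, forall x, (Lspace_of_bm bf : T -> R) x = f x}.
Proof.
have := Lspace_ofK (Lfun_Sub (lee1n 2) (bmfun_Lfun2 nu bf)).
by apply: filterS => x; exact.
Qed.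

Lemma Lspace_aeP (u v : L2) :
  u = v <-> {ae nu, forall x, (u : T -> R) x = (v : T -> R) x}.
Proof.
rewrite Lspace_eqP; split; first by apply: filterS => x; exact.
by apply: filterS => x uv _.
Qed.

Lemma Lspace0E : {ae nu, forall x, ((0 : L2) : T -> R) x = 0}.
Proof.
have := Lspace_ofK (0 : LfunType nu (lee1n 2)).
by apply: filterS => x /(_ I).
Qed.

Lemma LspaceZE a (u : L2) :
  {ae nu, forall x, ((a *: u : L2) : T -> R) x = a * (u : T -> R) x}.
Proof.
have := Lspace_linE a u 0; rewrite addr0 => H.
by apply: filterS2 H Lspace0E => x /(_ I) -> ->; rewrite addr0.
Qed.

Lemma Lspace_sumE n (c : 'I_n -> R) (u : 'I_n -> L2) (f : 'I_n -> T -> R) :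
  (forall i, {ae nu, forall x, (u i : T -> R) x = f i x}) ->
  {ae nu, forall x, ((\sum_i c i *: u i : L2) : T -> R) x = \sum_i c i * f i x}.
Proof.
elim: n c u f => [|n IH] c u f uf.
  by rewrite big_ord0; apply: filterS Lspace0E => x ->; rewrite big_ord0.
rewrite big_ord_recl.
have := IH (fun i => c (lift ord0 i)) (fun i => u (lift ord0 i)) _ (fun i => uf (lift ord0 i)).
move=> H1; have H2 := Lspace_linE (c ord0) (u ord0)
  (\sum_(i < n) c (lift ord0 i) *: u (lift ord0 i)).
apply: filterS3 H1 H2 (uf ord0) => x E1 /(_ I) E2 E3.
by rewrite big_ord_recl E2 E1 E3.
Qed.

Lemma linearly_independentP n (u : 'I_n -> L2) (f : 'I_n -> T -> R) :
  (forall i, {ae nu, forall x, (u i : T -> R) x = f i x}) ->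
  linearly_independent u <-> ae_independent f.
Proof.
move=> uf; split=> H c cE; apply: H.
  apply/Lspace_aeP; apply: filterS3 (Lspace_sumE c uf) Lspace0E cE => x -> -> //.
have := (Lspace_aeP _ _).1 cE => {}cE.
by apply: filterS3 (Lspace_sumE c uf) Lspace0E cE => x -> ->.
Qed.

Lemma kernel_op_aeE (u : L2) : {ae nu, forall x, (kernel_op nu W u : T -> R) x = K u x}.
Proof. by have := kernel_opE W u; apply: filterS => x; exact. Qed.

Lemma K_ae_eq f g x : f \in Lfun nu 2%:E -> g \in Lfun nu 2%:E ->
  {ae nu, forall x, f x = g x} -> K f x = K g x.
Proof.
by move=> f2 g2 fg; apply: kernel_integral_ae => //; apply: filterS fg => y.
Qed.

(** The representative is T u / l: it is bounded, and it satisfies the equation everywhere because T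
    u depends only on the class of u. *)
Lemma eigenvector_rep l (u : L2) : l != 0 -> kernel_op nu W u = l *: u ->
  exists f, eigenfunction nu W l f /\ {ae nu, forall x, (u : T -> R) x = f x}.
Proof.
move=> l0 Ku; have u2 := Lfun_of_subproof u.
have bKu := bmfunK_Lfun2 W u2.
exists (fun x => l^-1 * K u x).
have uE : {ae nu, forall x, (u : T -> R) x = l^-1 * K u x}.
  have := (Lspace_aeP _ _).1 Ku => {}Ku.
  by apply: filterS3 (kernel_op_aeE u) (LspaceZE l u) Ku => x E1 E2 E3;
    rewrite -[LHS](mulKf l0) -E2; congr (_ * _); exact: etrans (esym E3) E1.
split=> //; split=> [|x]; first exact: bmfunZ.
rewrite mulVKf//; apply: K_ae_eq => //; first exact/bmfun_Lfun2/bmfunZ.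
by apply: filterS uE.
Qed.

Lemma ae_eigenfunction_op l f (u : L2) : ae_eigenfunction l f ->
  {ae nu, forall x, (u : T -> R) x = f x} -> kernel_op nu W u = l *: u.
Proof.
move=> [bf Kf] uf; apply/Lspace_aeP.
have KE x : K u x = K f x.
  by apply: K_ae_eq => //; [exact: Lfun_of_subproof|exact: bmfun_Lfun2].
have H : {ae nu, forall x, K f x = l * (u : T -> R) x}.
  by apply: filterS2 uf Kf => x -> ->.
by apply: filterS3 (kernel_op_aeE u) (LspaceZE l u) H => x -> ->; rewrite KE.
Qed.

Lemma ae_eigenvector l f (ef : ae_eigenfunction l f) :
  kernel_op nu W (Lspace_of_bm ef.1) = l *: Lspace_of_bm ef.1.
Proof. exact: ae_eigenfunction_op ef (Lspace_of_bmE _). Qed.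

Lemma eigenfunction_ae l f : eigenfunction nu W l f -> ae_eigenfunction l f.
Proof. by move=> [bf Kf]; split=> //; apply: aeW. Qed.

Lemma is_eigenvalueP l : l != 0 -> is_eigenvalue (kernel_op nu W) l <->
  exists2 f, ae_eigenfunction l f & ~ {ae nu, forall x, f x = 0}.
Proof.
move=> l0; split.
- move=> [u u0 Ku]; have [f [ef uf]] := eigenvector_rep l0 Ku.
  exists f; first exact: eigenfunction_ae.
  move=> f0; move/eqP: u0; apply; apply/Lspace_aeP.
  by apply: filterS3 uf f0 Lspace0E => x -> -> ->.
- move=> [f ef f0]; exists (Lspace_of_bm ef.1); last exact: ae_eigenvector.
  apply/eqP => /Lspace_aeP u0; apply: f0.
  by apply: filterS3 (Lspace_of_bmE ef.1) u0 Lspace0E => x -> -> ->.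
Qed.

Lemma multiplicityE l : l != 0 -> multiplicity (kernel_op nu W) l
  = ereal_sup [set n%:R%:E | n in [set n | eigenfamily l n]].
Proof.
move=> l0; rewrite /multiplicity /dimension; congr ereal_sup; congr image.
apply/seteqP; split => n /=.
- move=> [v [vS vi]].
  have Kv i : kernel_op nu W (v i) = l *: v i by apply: vS; exists i.
  have /choice[f Hf] i := eigenvector_rep l0 (Kv i).
  exists f; split; first by move=> i; apply: eigenfunction_ae; case: (Hf i).
  by apply/(linearly_independentP (u := v)) => // i; case: (Hf i).
- move=> [f [ef fi]]; exists (fun i => Lspace_of_bm (ef i).1); split.
    by move=> _ [i _ <-] /=; exact: ae_eigenvector.
  apply/(linearly_independentP (f := f)) => // i; exact: Lspace_of_bmE.
Qed.

(** The functions are replaced by pointwise representatives, to which [eigenfunctions_dependent]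
    applies. *)
Lemma eigenfamily_bounded l : l != 0 ->
  exists k, forall n, eigenfamily l n -> (n <= k)%N.
Proof.
move=> l0; have [k Hk] := @eigenfunctions_dependent _ _ _ nu W l l0; exists k => n [f [ef fi]].
rewrite leqNgt; apply/negP => kn.
have Kv i : kernel_op nu W (Lspace_of_bm (ef i).1) = l *: (Lspace_of_bm (ef i).1).
  exact: ae_eigenvector.
have /choice[g Hg] i := eigenvector_rep l0 (Kv i).
have [c [[i ci] cg]] := Hk n g kn (fun i => (Hg i).1).
move/eqP: ci; apply; apply: fi.
have H : {ae nu, forall x, forall i, f i x = g i x}.
  apply: filter_forall => j.
  by apply: filterS2 (Hg j).2 (Lspace_of_bmE (ef j).1) => x -> ->.
apply: filterS H => x H; rewrite -[RHS](cg x); apply: eq_bigr => j _.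
by rewrite H.
Qed.

End Lspace_eigen.

(** * The sign flip *)

Section sign_flip.
Context d (T : measurableType d) (R : realType) (nu : probability T R).
Variables (W : graphon T R).
Implicit Types A B C : set T.
Local Notation K := (kernel_integral nu W).

(** The functions are quantified inside the a.e. statement: one exceptional null set serves all f
    and g. *)
Lemma no_edges_K A C : no_edges nu W A C -> {ae nu, forall x, A x ->
  forall f g, bmfun f -> bmfun g -> (forall y, ~ C y -> f y = g y) -> K f x = K g x}.
Proof.
rewrite /no_edges => AC0; apply: filterS AC0 => x H /H {}H f g bf bg fg.
congr fine; apply: ae_eq_integral => //.
- exact: measurable_int (kernel_integrable W x (bmfun_Lfun2 nu bf)).
- exact: measurable_int (kernel_integrable W x (bmfun_Lfun2 nu bg)).
- apply: filterS H => y H _; congr EFin.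
  have [/H ->|/fg -> //] := pselect (C y).
  by rewrite !mul0r.
Qed.

Definition sign_of A B (x : T) : R := \1_A x - \1_B x.

Lemma bmfun_sign_of A B : measurable A -> measurable B -> bmfun (sign_of A B).
Proof. by move=> mA mB; apply: bmfunB; exact: bmfun_indic. Qed.

Lemma sign_ofl A B x : A `&` B = set0 -> A x -> sign_of A B x = 1.
Proof.
move=> AB0 Ax; rewrite /sign_of !indicE mem_set// memNset ?subr0//.
by move=> Bx; have : (A `&` B) x by []; rewrite AB0.
Qed.

Lemma sign_ofr A B x : A `&` B = set0 -> B x -> sign_of A B x = - 1.
Proof.
move=> AB0 Bx; rewrite /sign_of !indicE (mem_set Bx) memNset ?sub0r//.
by move=> Ax; have : (A `&` B) x by []; rewrite AB0.
Qed.

Lemma sign_of0 A B x : ~ (A `|` B) x -> sign_of A B x = 0.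
Proof.
move=> ABx; rewrite /sign_of !indicE !memNset ?subrr// => ?; apply: ABx.
- by right.
- by left.
Qed.

Lemma sign_of_sqr A B x : A `&` B = set0 -> (A `|` B) x ->
  sign_of A B x * sign_of A B x = 1.
Proof.
by move=> AB0 [?|?]; [rewrite sign_ofl// mulr1|rewrite sign_ofr// mulrNN mulr1].
Qed.

(** Almost every x in A sees only B and conversely, so the sign changes along edges; almost every x
    outside A u B sees neither side, and there both members are 0. *)
Lemma K_sign_of A B f : bipartite_pair nu W A B -> bmfun f ->
  {ae nu, forall x, K (fun y => sign_of A B y * f y) x = - sign_of A B x * K f x}.
Proof.
move=> bAB bf; have [mA mB AB0 nA nB] := bAB.
have bs := bmfun_sign_of mA mB; have bsf := bmfunM bs bf.
have nS := bipartite_pair_setC_no_edges bAB.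
apply: filterS3 (no_edges_K nA) (no_edges_K nB) (no_edges_K nS) => x HA HB HS.
have [Ax|Ax] := pselect (A x).
  rewrite (HA Ax _ (fun y => -1 * f y))//; [|exact: bmfunZ|].
    by rewrite KZ// sign_ofl.
  by move=> y /contrapT By; rewrite sign_ofr.
have [Bx|Bx] := pselect (B x).
  rewrite (HB Bx _ f)//; first by rewrite sign_ofr// opprK mul1r.
  by move=> y /contrapT Ay; rewrite sign_ofl// mul1r.
have ABx : (~` (A `|` B)) x by case.
rewrite (HS ABx _ (fun y => 0 * f y))//; [|exact: bmfunZ|].
  by rewrite KZ// sign_of0// oppr0 !mul0r.
by move=> y ABy; rewrite sign_of0.
Qed.

Lemma sign_of_eigenfunction A B l f : bipartite_pair nu W A B -> ae_eigenfunction nu W l f ->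
  ae_eigenfunction nu W (- l) (fun x => sign_of A B x * f x).
Proof.
move=> bAB [bf Kf]; have [mA mB _ _ _] := bAB.
split; first exact: (bmfunM (bmfun_sign_of mA mB) bf).
by apply: filterS2 (K_sign_of bAB bf) Kf => x -> ->; rewrite mulNr mulrCA mulNr.
Qed.

(** As A and B cover the space, the sign squares to 1 everywhere, so multiplying by it preserves
    independence. *)
Lemma bipartite_pair_setT_eigenfamily A B l n : bipartite_pair nu W A B -> A `|` B = setT ->
  eigenfamily nu W l n -> eigenfamily nu W (- l) n.
Proof.
move=> bAB ABT [f [ef fi]]; exists (fun i x => sign_of A B x * f i x); split.
  by move=> i; exact: sign_of_eigenfunction.
have s2 x : sign_of A B x * sign_of A B x = 1.
  by case: bAB => _ _ AB0 _ _; rewrite sign_of_sqr// ABT.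
move=> c cf; apply: fi; apply: filterS cf => x H.
transitivity (sign_of A B x * \sum_i c i * (sign_of A B x * f i x)); last by rewrite H mulr0.
rewrite mulr_sumr; apply: eq_bigr => i _.
by rewrite [RHS]mulrCA [X in _ = c i * X]mulrA s2 mul1r.
Qed.

Lemma bipartite_pair_setT_symmetric_spectrum A B : bipartite_pair nu W A B -> A `|` B = setT ->
  symmetric_spectrum (kernel_op nu W).
Proof.
move=> bAB ABT l; have [->|l0] := eqVneq l 0; first by rewrite oppr0.
have Nl0 : - l != 0 by rewrite oppr_eq0.
have eig m n : eigenfamily nu W m n -> eigenfamily nu W (- m) n.
  exact: (bipartite_pair_setT_eigenfamily bAB ABT).
split.
  have H m : m != 0 -> is_eigenvalue (kernel_op nu W) m -> is_eigenvalue (kernel_op nu W) (- m).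
    move=> m0 /(is_eigenvalueP nu W m0)[f ef f0].
    apply/is_eigenvalueP; first by rewrite oppr_eq0.
    exists (fun x => sign_of A B x * f x); first exact: sign_of_eigenfunction.
    move=> H; apply: f0; apply: filterS H => x /eqP; rewrite mulf_eq0 => /orP[/eqP s0|/eqP//].
    have [_ _ AB0 _ _] := bAB; have : sign_of A B x * sign_of A B x = 1.
      by rewrite sign_of_sqr// ABT.
    by rewrite s0 mul0r => /eqP; rewrite eq_sym oner_eq0.
  by split=> [|/H]; [exact: H|rewrite opprK; exact].
rewrite !multiplicityE//; congr ereal_sup; congr image; apply/seteqP.
split => n /=; first exact: eig.
by move=> /eig; rewrite opprK.
Qed.

End sign_flip.

(** * Eigenfunctions in the complement of a bipartite pair *)

Section outside.
Context d (T : measurableType d) (R : realType) (nu : probability T R).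
Variables (W : graphon T R) (A B : set T).
Hypothesis bAB : bipartite_pair nu W A B.
Local Notation K := (kernel_integral nu W).
Local Notation S := (~` (A `|` B)).
Hypothesis mS : measurable S.
Local Notation WS := (restrict_graphon W mS).

Lemma eigenfunction_restrict_outside l v : l != 0 -> eigenfunction nu WS l v ->
  forall x, ~ S x -> v x = 0.
Proof.
move=> l0 [bv Kv] x Sx; apply: (mulfI l0).
by rewrite mulr0 -Kv K_restrict// indicE memNset// mul0r.
Qed.

(** Since v lives on S, T v agrees on S with the restricted operator, and off S it vanishes a.e.
    because no edges join A u B to S. *)
Lemma eigenfunction_restrict l v : l != 0 -> eigenfunction nu WS l v ->
  ae_eigenfunction nu W l v.
Proof.
move=> l0 ev; have v0 := eigenfunction_restrict_outside l0 ev.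
have [bv Kv] := ev; split=> //.
have Sv : (fun y => \1_S y * v y) = v.
  apply/funext => y; rewrite indicE.
  case: (boolP (y \in S)) => [_|/negP yS]; first by rewrite mul1r.
  by rewrite v0 ?mulr0// => Sy; apply: yS; exact: mem_set.
have [mA mB _ _ _] := bAB.
have := no_edges_sym mS (measurableU _ _ mA mB) (bipartite_pair_setC_no_edges bAB).
move=> /no_edges_K; apply: filterS => x H.
rewrite -Kv K_restrict// Sv indicE.
have [Sx|Sx] := pselect (S x); first by rewrite mem_set// mul1r.
rewrite (H _ _ (fun y => 0 * v y)) ?memNset ?KZ ?mul0r//; first exact: contrapT.
- exact: bmfunZ.
- by move=> y Sy; rewrite v0// mul0r.
Qed.

Lemma restrict_ae_eigenfunction m u : ae_eigenfunction nu W m u ->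
  ae_eigenfunction nu WS m (fun x => \1_S x * u x).
Proof.
move=> [bu Ku].
have b1 : bmfun (fun x => \1_S x * u x) by apply: bmfunM => //; exact: bmfun_indic.
split=> //; apply: filterS2 Ku (no_edges_K (bipartite_pair_setC_no_edges bAB)) => x Kux H.
rewrite K_restrict// [RHS]mulrCA.
have [Sx|Sx] := pselect (S x); last by rewrite indicE memNset// !mul0r.
congr (_ * _); rewrite -Kux; apply: H => //.
  by apply: bmfunM => //; exact: bmfun_indic.
by move=> y Sy; rewrite !indicE !mem_set// !mul1r.
Qed.

(** Otherwise, flip an independent family of (-l)-eigenfunctions of maximal size, which exists as
    multiplicities are finite. The results are supported on A u B, so v is independent of them and
    the multiplicity of l exceeds that of -l. *)
Lemma negative_eigenfunction_outside l v : l != 0 ->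
  multiplicity (kernel_op nu W) l = multiplicity (kernel_op nu W) (- l) ->
  ae_eigenfunction nu W l v -> (forall x, ~ S x -> v x = 0) ->
  ~ {ae nu, forall x, v x = 0} ->
  exists u, ae_eigenfunction nu W (- l) u /\ ~ {ae nu, forall x, S x -> u x = 0}.
Proof.
move=> l0 ml ev vS v0; apply: contrapT => H.
have {}H u : ae_eigenfunction nu W (- l) u -> {ae nu, forall x, S x -> u x = 0}.
  by move=> eu; apply: contrapT => u0; apply: H; exists u.
have Nl0 : - l != 0 by rewrite oppr_eq0.
have [k Hk] := eigenfamily_bounded nu W Nl0.
have ex0 : exists n, `[< eigenfamily nu W (- l) n >].
  by exists 0; apply/asboolP; exists (fun _ => cst 0); split => [[]//|c _ []].
have ubk n : `[< eigenfamily nu W (- l) n >] -> (n <= k)%N by move=> /asboolP; exact: Hk.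
have [n /asboolP[u [eu ui]] nmax] := ex_maxnP ex0 ubk.
have [_ _ AB0 _ _] := bAB.
suff : eigenfamily nu W l n.+1.
  move=> fam; have : (n.+1%:R%:E <= multiplicity (kernel_op nu W) l)%E.
    by rewrite multiplicityE//; apply: ereal_sup_ubound; exists n.+1.
  rewrite ml multiplicityE// leNgt => /negP; apply.
  apply: (@le_lt_trans _ _ n%:R%:E); last by rewrite lte_fin ltr_nat.
  by apply: ge_ereal_sup => _ [m /= Hm <-]; rewrite lee_fin ler_nat; apply: nmax; apply/asboolP.
exists (fun i => oapp (fun j x => sign_of R A B x * u j x) v (unlift ord0 i)); split.
  move=> i; case: unliftP => [j _|_] //=; rewrite -[l]opprK.
  exact: sign_of_eigenfunction.
move=> c cE0.
have cE : {ae nu, forall x,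
    c ord0 * v x + \sum_(j < n) c (lift ord0 j) * (sign_of R A B x * u j x) = 0}.
  apply: filterS cE0 => x; rewrite big_ord_recl unlift_none => E.
  apply: etrans E; congr (_ + _).
  by apply: eq_bigr => j _; rewrite liftK.
have uS : {ae nu, forall x, forall j, S x -> u j x = 0}.
  by apply: filter_forall => j; exact: H.
(* On S the flipped functions vanish, which leaves c_0 v = 0 there; off S the function v is zero
   already. *)
have c0 : c ord0 = 0.
  apply/eqP; apply: contrapT => /negP c0; apply: v0; apply: filterS cE => x.
  have [Sx|/vS //] := pselect (S x).
  rewrite big1 => [|j _]; last by rewrite sign_of0// mul0r mulr0.
  by rewrite addr0 => /eqP; rewrite mulf_eq0 (negPf c0) => /eqP.
(* Multiplying by the sign again undoes the flip on A u B, and on S the u_j vanish a.e.; so the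
   relation holds for the u_j a.e. on the whole space. *)
have cl : forall j, c (lift ord0 j) = 0.
  apply: (ui (fun j => c (lift ord0 j))); apply: filterS2 cE uS => x + uSx.
  have [Sx _|/contrapT ABx] := pselect (S x).
    by rewrite big1// => j _; rewrite uSx// mulr0.
  rewrite c0 mul0r add0r => E.
  transitivity (sign_of R A B x *
      \sum_(j < n) c (lift ord0 j) * (sign_of R A B x * u j x)).
    rewrite mulr_sumr; apply: eq_bigr => j _; rewrite [RHS]mulrCA.
    by rewrite [X in _ = _ * X]mulrA sign_of_sqr// mul1r.
  by rewrite E mulr0.
by move=> i; case: (unliftP ord0 i) => [j ->|->].
Qed.

End outside.

(** * The equivalence *)

Section main.
Context d (T : measurableType d) (R : realType) (nu : probability T R).
Variable W : graphon T R.

Lemma bipartite_pair_setT_bipartite A B : bipartite_pair nu W A B ->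
  A `|` B = setT -> bipartite nu W.
Proof.
move=> [mA mB AB0 nA nB] ABT; exists A, B; split=> //; split; apply/no_edgesP => //.
  apply: no_edgesS nA => // x Ax Bx.
  by have : (A `&` B) x by []; rewrite AB0.
apply: no_edgesS nB => // x Bx Ax.
by have : (A `&` B) x by []; rewrite AB0.
Qed.

Lemma bipartite_exists_pair : bipartite nu W ->
  exists A B, bipartite_pair nu W A B /\ A `|` B = setT.
Proof.
move=> [A [B [mA mB ABT AB0 [/no_edgesP nA /no_edgesP nB]]]]; exists A, B; split => //.
have AB x : A x \/ B x by change ((A `|` B) x); rewrite ABT.
split=> //.
- by apply: no_edgesS (nA mA mA) => // x Bx; case: (AB x).
- by apply: no_edgesS (nB mB mB) => // x Ax; case: (AB x).
Qed.

Lemma symmetric_spectrum_bipartite :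
  symmetric_spectrum (kernel_op nu W) -> bipartite nu W.
Proof.
move=> sym; have [A [B [bAB ABmax]]] := bipartite_pair_maximal nu W.
have [mA mB AB0 nA nB] := bAB.
pose S := ~` (A `|` B).
have mS : measurable S by exact/measurableC/measurableU.
pose WS := restrict_graphon W mS.
have := K_sqnorm_ge0 nu WS; rewrite le_eqVlt => /predU1P[/esym s0|s0].
  (* In this case S meets no edges, neither inside itself nor towards A u B, so it can be added to
     A. *)
  have SS : no_edges nu W S S.
    have := K_sqnorm_eq0 s0; rewrite /no_edges; apply: filterS => x H Sx.
    apply: filterS (H I) => y {}H Sy; have := H I.
    by rewrite /= /restrict_fun /= !indicE !mem_set ?mul1r ?mulr1.
  have SA : no_edges nu W S A.
    by apply: no_edgesS (bipartite_pair_setC_no_edges bAB) => // x; left.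
  have AS : no_edges nu W A S by exact: no_edges_sym SA.
  apply: (@bipartite_pair_setT_bipartite (A `|` S) B).
    split=> //; first exact: measurableU.
    - apply/seteqP; split => // x [[Ax|ABx] Bx]; last by apply: ABx; right.
      by rewrite -AB0.
    - apply: no_edgesU1.
        by [].
      apply: (@no_edgesS _ _ _ _ _ S (A `|` S)) => //; last exact: no_edgesU2.
      by move=> x Bx; have [?|?] := pselect (A x); [left|right; case].
    - by apply: no_edgesS nB => // x H Ax; apply: H; left.
  apply/seteqP; split => // x _.
  by have [[?|?]|?] := pselect ((A `|` B) x); [left; left|right|left; right].
have [v bv [[x vx] Kv]] := top_eigenvector s0.
set l := Num.sqrt _ in Kv.
have lgt0 : 0 < l by rewrite sqrtr_gt0.
have l0 : l != 0 by rewrite gt_eqF.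
have Nl0 : - l != 0 by rewrite oppr_eq0.
have ev : eigenfunction nu WS l v by [].
have v0 : ~ {ae nu, forall x, v x = 0}.
  by move=> /(eigenfunction_ae0 l0 ev) /(_ x) vx0; rewrite vx0 eqxx in vx.
have [u [eu u0]] := negative_eigenfunction_outside bAB l0 (sym l).2
  (eigenfunction_restrict bAB l0 ev) (eigenfunction_restrict_outside l0 ev) v0.
have eSu := restrict_ae_eigenfunction bAB mS eu.
(* The function u cut down to S is exchanged for its pointwise representative g, which vanishes
   everywhere off S, so that its positive and negative sets lie in S. *)
have [g [eg gu]] := eigenvector_rep Nl0 (ae_eigenvector eSu).
have gS := eigenfunction_restrict_outside Nl0 eg.
have [bg Kg] := eg.
have bg' : bipartite_pair nu WS [set x | 0 < g x] [set x | g x < 0].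
  apply: (@negative_eigenfunction_bipartite_pair _ _ _ _ _ l) => // f bf.
  by rewrite sqr_sqrtr ?(ltW s0)//; exact: ip_K_sqnorm.
have gpS : [set x | 0 < g x] `<=` S.
  by move=> y /= gy; apply: contrapT => /gS gy0; rewrite gy0 ltxx in gy.
have gnS : [set x | g x < 0] `<=` S.
  by move=> y /= gy; apply: contrapT => /gS gy0; rewrite gy0 ltxx in gy.
have := ABmax _ _ (bipartite_pair_extend bAB gpS gnS bg').
set G := [set x | 0 < g x] `|` [set x | g x < 0].
have mG : measurable G by case: bg' => *; exact: measurableU.
have GS : G `<=` S by move=> y [/gpS|/gnS].
(* Additivity turns maximality into nu G <= 0. Then g vanishes a.e., hence so does u on S, against
   the choice of u. *)
rewrite setUACA measureU//; [|exact: measurableU|]; last first.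
  by apply/seteqP; split => // y [ABy /GS].
rewrite -leeBrDl ?fin_num_measure//; last exact: measurableU.
rewrite subee ?fin_num_measure//; last exact: measurableU.
move=> nuG; exfalso; apply: u0.
have /negligibleP -/(_ mG) [N [mN N0 GN]] : nu G = 0%E.
  by apply/eqP; rewrite eq_le nuG measure_ge0.
have g0 : {ae nu, forall x, g x = 0}.
  exists N; split=> // y /= gy; apply: GN; apply: contrapT => Gy; apply: gy.
  by apply: contrapT => /eqP; rewrite neq_lt => /orP[?|?]; apply: Gy; [right|left].
have := Lspace_of_bmE nu eSu.1; move: gu g0; apply: filterS3 => y -> -> /esym.
by move=> H Sy; move: H; rewrite indicE mem_set// mul1r.
Qed.

Lemma bipartite_symmetric_spectrumP :
  bipartite nu W <-> symmetric_spectrum (kernel_op nu W).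
Proof.
split=> [/bipartite_exists_pair[A [B [bAB ABT]]]|]; last exact: symmetric_spectrum_bipartite.
exact: bipartite_pair_setT_symmetric_spectrum bAB ABT.
Qed.

End main.

Theorem theorem8 (R : realType) (d : measure_display) (Omega : measurableType d)
    (nu : probability Omega R) (W : graphon Omega R) :
  standard_borel Omega R -> atomless nu ->
  (bipartite nu W <-> symmetric_spectrum (kernel_op nu W)).
Proof. by move=> _ _; exact: bipartite_symmetric_spectrumP. Qed.
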